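(* Fix $s\in[0,1]$ and $r\in[H^{-1}(1-s),\,1/2-H^{-1}(s)]$. For every $Y\in2^\omega$ with $\dim(Y)=1$ there is a sequence $X$ of dimension exactly $s$ such that $d(X,1)=r$ and $d(X,Y)=r$.
   Context: $K$ is prefix-free Kolmogorov complexity; $\dim(X)=\liminf_n K(X\restriction n)/n$, $\dim_P(X)=\limsup_n K(X\restriction n)/n$; dimension exactly $s$ means $\dim(X)=\dim_P(X)=s$. $d(X,Y)=\limsup_{n}|\{m<n:X(m)\ne Y(m)\}|/n$, and $d(X,1)=\inf\{d(X,Z):\dim(Z)=1\}$. $H$ is binary entropy and $H^{-1}:[0,1]\to[0,1/2]$ its inverse on $[0,1/2]$. *)

(* Defs.v *)
From HB Require Import structures.
From mathcomp Require Import all_boot all_order all_algebra.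
From mathcomp Require Import all_classical all_reals all_analysis.
Set Implicit Arguments. Unset Strict Implicit. Unset Printing Implicit Defensive.
Import Order.TTheory GRing.Theory Num.Theory.
Local Open Scope classical_set_scope.
Local Open Scope ring_scope.

Definition cpair (x y : nat) : nat := ((x + y) * (x + y).+1) %/ 2 + y.

Inductive prcode : Type :=
| PZero
| PSucc
| PId
| PFst
| PSnd
| PComp of prcode & prcode
| PPair of prcode & prcode
| PPrec of prcode & prcode
| PMu of prcode.

Inductive peval : prcode -> nat -> nat -> Prop :=
| ev_zero x : peval PZero x 0
| ev_succ x : peval PSucc x x.+1
| ev_id x : peval PId x x
| ev_fst x y : peval PFst (cpair x y) x
| ev_snd x y : peval PSnd (cpair x y) y
| ev_comp f g x y z : peval g x y -> peval f y z -> peval (PComp f g) x z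
| ev_pair f g x y z : peval f x y -> peval g x z -> peval (PPair f g) x (cpair y z)
| ev_prec0 f g x y : peval f x y -> peval (PPrec f g) (cpair 0 x) y
| ev_precS f g n x y z :
    peval (PPrec f g) (cpair n x) y -> peval g (cpair n (cpair y x)) z ->
    peval (PPrec f g) (cpair n.+1 x) z
| ev_mu f x n :
    peval f (cpair n x) 0 ->
    (forall m, (m < n)%N -> exists v, v <> 0 /\ peval f (cpair m x) v) ->
    peval (PMu f) x n.

(* Bijective encoding of binary strings as natural numbers. *)
Fixpoint benc (s : seq bool) : nat :=
  match s with
  | [::] => 0
  | b :: t => (benc t).*2 + b + 1
  end.

Definition describes (M : prcode) (p sigma : seq bool) : Prop :=
  peval M (benc p) (benc sigma).

Definition prefix_free_machine (M : prcode) : Prop :=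
  forall p q y z, peval M (benc p) y -> peval M (benc q) z ->
    prefix p q -> p = q.

Definition optimal_pf_machine (U : prcode) : Prop :=
  prefix_free_machine U /\
  forall M, prefix_free_machine M -> exists c : nat,
    forall p sigma, describes M p sigma ->
      exists q, describes U q sigma /\ (size q <= size p + c)%N.

Definition KU {R : realType} (U : prcode) (sigma : seq bool) : R :=
  inf [set (size p)%:R | p in [set p | describes U p sigma]].

Definition restr (X : nat -> bool) (n : nat) : seq bool := mkseq X n.

Local Open Scope ereal_scope.

Definition cdim {R : realType} (U : prcode) (X : nat -> bool) : \bar R :=
  limn_einf (fun n => (KU U (restr X n) / n%:R)%R%:E).

Definition pdim {R : realType} (U : prcode) (X : nat -> bool) : \bar R :=
  limn_esup (fun n => (KU U (restr X n) / n%:R)%R%:E).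

Definition hdist {R : realType} (X Y : nat -> bool) : \bar R :=
  limn_esup (fun n => ((#|[set m : 'I_n | X m != Y m]|)%:R / n%:R : R)%R%:E).

Definition dist1 {R : realType} (U : prcode) (X : nat -> bool) : \bar R :=
  ereal_inf [set hdist X Z | Z in [set Z | cdim U Z = (1%R : R)%:E]].

Local Close Scope ereal_scope.

Definition xlog2x {R : realType} (x : R) : R :=
  if x == 0 then 0 else x * (ln x / ln 2).

Definition Hbin {R : realType} (x : R) : R := - xlog2x x - xlog2x (1 - x).

Definition Hinv {R : realType} (t : R) : R :=
  xget 0 [set x : R | 0 <= x <= 2^-1 /\ Hbin x = t].

(* Main.v *)
(* Let [Y] have dimension 1. Cut [Y] into blocks of slowly growing length [m] and
   replace each block [y] by [F y], for a finite map [F] on strings of length [m]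
   whose image has at most [2^((s+o(1))m)] elements, whose fibres have at most
   [2^((1-s+o(1))m)] elements, and such that [F y] is at distance about [r * m] from
   [y] and at least about [r * m] from every [z], up to an exceptional set of strings
   of size at most [2^((1-delta)m)].  Listing the image shows K(X|n) <= (s+o(1))n;
   recovering [Y] from [X] and the positions in the fibres shows
   K(Y|n) <= K(X|n) + (1-s+o(1))n; and a sequence of dimension 1 has few exceptional
   blocks, as these compress.  The tables of [F] are hardwired in the decoders: the
   resulting machine-dependent constants are absorbed because the block length grows
   as slowly as needed, so [F] need not be computable in a uniform way.

   For the smallest [r] the map [F] sends [y] to the nearest word of a covering code;
   for the largest it sends [y] to a subset of [y] of size [p * m], where H(p) = s,
   chosen so that the fibres are balanced.  For [r] in between, use the first map on
   a fraction of the coordinates and the second one on the others. *)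
Require Import Defs.
From HB Require Import structures.
From mathcomp Require Import all_boot all_order all_algebra.
From mathcomp Require Import all_classical all_reals all_analysis.
From mathcomp Require Import zify ring lra.
Import Order.TTheory GRing.Theory Num.Theory numFieldNormedType.Exports.
Set Implicit Arguments. Unset Strict Implicit. Unset Printing Implicit Defensive.

(** * Computable functions and the codes [prcode] *)

Local Open Scope nat_scope.

(** Dimension 1 comes without a rate of convergence, so the block length cannot be adapted to [Y],
    still less to the competing sequences [Z]. Therefore one map [F] has to serve all tolerances e
    at once, with exceptional sets whose saving depends on e but not on the block length; e tends to
    0 only after n tends to infinity. A lower bound on K(X|n) is not accessible directly: it is
    borrowed from [Y] through the small fibres. The image of a covering code is far from most
    strings because 2^(sm) balls of radius (r - e)m, where s = 1 - H(r), are too small to fill the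
    cube; a set of size p * m is far from most strings because these have weight about m/2. Both
    maps have the same s, so joining them preserves the exponents of image and fibres while the
    distances average. Prefix-freeness is bought with a factor 1 + O(1/t) in place of a logarithmic
    term: t grows with the stages, and only rates matter. *)

Lemma half_mulnS n : (n * n.+1) %/ 2 = 'C(n.+1, 2).
Proof. by rewrite bin2 divn2 mulnC. Qed.

Lemma cpair_lt x y x' y' : x + y < x' + y' -> cpair x y < cpair x' y'.
Proof.
rewrite /cpair !half_mulnS => h.
apply: (@leq_trans ('C((x + y).+2, 2))); last first.
  by apply: leq_trans (leq_addr _ _); apply: leq_bin2l; rewrite !ltnS.
by rewrite [X in _ < X]binS bin1 ltn_add2l ltnS leq_addl.
Qed.

Lemma cpair_inj x y x' y' : cpair x y = cpair x' y' -> x = x' /\ y = y'.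
Proof.
move=> h; have e : x + y = x' + y'.
  by case: (ltngtP (x + y) (x' + y')) => // /cpair_lt; rewrite h ltnn.
by move: h; rewrite /cpair e => /addnI; lia.
Qed.

(** [cpair] is a function and not a constructor, so inversion cannot match on pairs: the input stays
    a variable, and the equations are left to [cpair_inj]. *)
Lemma peval_prec_inv f g w y : peval (PPrec f g) w y ->
  (exists x, w = cpair 0 x /\ peval f x y) \/
  (exists n x p, [/\ w = cpair n.+1 x, peval (PPrec f g) (cpair n x) p &
                     peval g (cpair n (cpair p x)) y]).
Proof.
move=> h; inversion h; subst; [left; by eexists|right].
by do 3 eexists; split; eauto.
Qed.

Lemma peval_det M x y z : peval M x y -> peval M x z -> y = z.
Proof.
elim: M x y z => [||||| f IHf g IHg | f IHf g IHg | f IHf g IHg | f IHf] x y z.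
- by move=> h1 h2; inversion h1; inversion h2; subst.
- by move=> h1 h2; inversion h1; inversion h2; subst.
- by move=> h1 h2; inversion h1; inversion h2; subst.
- move=> h1 h2; inversion h1; inversion h2; subst.
  by match goal with H : cpair _ _ = cpair _ _ |- _ => case: (cpair_inj H) end.
- move=> h1 h2; inversion h1; inversion h2; subst.
  by match goal with H : cpair _ _ = cpair _ _ |- _ => case: (cpair_inj H) end.
- move=> h1 h2; inversion h1 as [| | | | |? ? ? a ? ha hb| | | |]; subst.
  inversion h2 as [| | | | |? ? ? a' ? ha' hb'| | | |]; subst.
  by rewrite (IHg _ _ _ ha' ha) in hb'; exact: IHf hb hb'.
- move=> h1 h2; inversion h1 as [| | | | | |? ? ? a b ha hb| | |]; subst.
  inversion h2 as [| | | | | |? ? ? a' b' ha' hb'| | |]; subst.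
  by rewrite (IHf _ _ _ ha' ha) (IHg _ _ _ hb' hb).
(* The induction on codes says nothing on [PPrec f g] at smaller counters, hence an inner induction
   on the counter. *)
- have H n a : forall y z, peval (PPrec f g) (cpair n a) y ->
      peval (PPrec f g) (cpair n a) z -> y = z.
    elim: n => [|n IHn] {}y {}z h1 h2.
      case: (peval_prec_inv h1) => [[a1 [/cpair_inj[_ ea] ha]]|[? [? [? []]]]];
        last by move=> /cpair_inj[].
      case: (peval_prec_inv h2) => [[a2 [/cpair_inj[_ ea2] ha2]]|[? [? [? []]]]];
        last by move=> /cpair_inj[].
      by subst; exact: IHf ha ha2.
    case: (peval_prec_inv h1) => [[? []]|[n1 [a1 [p1 [/cpair_inj[[?] ?] ha hb]]]]];
      first by move=> /cpair_inj[].
    case: (peval_prec_inv h2) => [[? []]|[n2 [a2 [p2 [/cpair_inj[[?] ?] ha2 hb2]]]]];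
      first by move=> /cpair_inj[].
    subst; rewrite (IHn _ _ ha2 ha) in hb2.
    exact: IHg hb hb2.
  move=> h1; case: (peval_prec_inv h1) => [[a [e _]]|[n [a [p [e _ _]]]]];
    by subst x; exact: H h1.
- move=> h1 h2.
  inversion h1 as [| | | | | | | | |? ? ? h0 hlt]; subst.
  inversion h2 as [| | | | | | | | |? ? ? h0' hlt']; subst.
  case: (ltngtP y z) => // lt.
  + have [v [v0 hv]] := hlt' _ lt.
    by case: v0; exact: IHf hv h0.
  + have [v [v0 hv]] := hlt _ lt.
    by case: v0; exact: IHf hv h0'.
Qed.

(** * Closure properties of total computable functions *)

Class coded (A : Type) := ncode : A -> nat.
#[export] Instance coded_nat : coded nat := fun n => n.
#[export] Instance coded_prod A B `{coded A} `{coded B} : coded (A * B) :=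
  fun p => cpair (ncode p.1) (ncode p.2).

Definition computable {A B} `{coded A} `{coded B} (f : A -> B) :=
  exists M, forall a, peval M (ncode a) (ncode (f a)).

Lemma computable_ext {A B} `{coded A} `{coded B} (f g : A -> B) :
  f =1 g -> computable f -> computable g.
Proof. by move=> e [M hM]; exists M => a; rewrite -e. Qed.

Lemma computable_id {A} `{coded A} : computable (fun a : A => a).
Proof. by exists PId => a; constructor. Qed.

Lemma computable_comp {A B C} `{coded A} `{coded B} `{coded C}
  (f : B -> C) (g : A -> B) :
  computable f -> computable g -> computable (fun a => f (g a)).
Proof.
by move=> [M hM] [N hN]; exists (PComp M N) => a; apply: ev_comp (hN a) (hM _).
Qed.

Lemma computable_pair {A B C} `{coded A} `{coded B} `{coded C}
  (f : A -> B) (g : A -> C) :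
  computable f -> computable g -> computable (fun a => (f a, g a)).
Proof.
by move=> [M hM] [N hN]; exists (PPair M N) => a; apply: ev_pair.
Qed.

Lemma computable_fst {A B C} `{coded A} `{coded B} `{coded C} (f : A -> B * C) :
  computable f -> computable (fun a => (f a).1).
Proof.
move=> [M hM]; exists (PComp PFst M) => a; apply: ev_comp (hM a) _.
exact: ev_fst.
Qed.

Lemma computable_snd {A B C} `{coded A} `{coded B} `{coded C} (f : A -> B * C) :
  computable f -> computable (fun a => (f a).2).
Proof.
move=> [M hM]; exists (PComp PSnd M) => a; apply: ev_comp (hM a) _.
exact: ev_snd.
Qed.

Lemma computable_succ {A} `{coded A} (f : A -> nat) :
  computable f -> computable (fun a => (f a).+1).
Proof.
by move=> [M hM]; exists (PComp PSucc M) => a; apply: ev_comp (hM a) (ev_succ _).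
Qed.

Lemma computable_const {A} `{coded A} (n : nat) : computable (fun _ : A => n).
Proof.
elim: n => [|n IHn]; last exact: computable_succ.
by exists PZero => a; constructor.
Qed.

Lemma computable_iter {A B} `{coded A} `{coded B} (n : A -> nat) (b : A -> B)
  (g : A -> B -> B) :
  computable n -> computable b -> computable (fun p : A * B => g p.1 p.2) ->
  computable (fun a => iter (n a) (g a) (b a)).
Proof.
move=> [N hN] [M hM] [G hG].
(* [PPrec] calls its step code on (counter, (accumulator, parameter)); [G'] drops the counter and
   swaps the other two. *)
pose G' := PComp G (PPair (PComp PSnd PSnd) (PComp PFst PSnd)).
exists (PComp (PPrec M G') (PPair N PId)) => a.
apply: ev_comp (ev_pair (hN a) (ev_id _)) _.
change (ncode (n a)) with (n a).
elim: (n a) => [|k IH] /=; first exact: ev_prec0.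
apply: ev_precS IH _; apply: ev_comp (hG (a, _)).
apply: ev_pair.
  by apply: ev_comp (ev_snd _ _) _; exact: ev_snd.
by apply: ev_comp (ev_snd _ _) _; exact: ev_fst.
Qed.

Lemma computable_mu {A} `{coded A} (g : nat * A -> nat) (f : A -> nat) :
  computable g -> (forall a, g (f a, a) = 0) ->
  (forall a m, m < f a -> g (m, a) != 0) -> computable f.
Proof.
move=> [G hG] h0 hlt; exists (PMu G) => a; apply: ev_mu => [|m hm].
  by have := hG (f a, a); rewrite h0.
by exists (g (m, a)); split; [apply/eqP; exact: hlt|exact: hG (m, a)].
Qed.

Lemma computable_add {A} `{coded A} (f g : A -> nat) :
  computable f -> computable g -> computable (fun a => f a + g a).
Proof.
move=> cf cg; apply: (@computable_ext _ _ _ _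
  (fun a => iter (f a) S (g a))).
  by move=> a; elim: (f a) => //= n ->.
apply: computable_iter => //.
by apply: computable_succ; apply: computable_snd; exact: computable_id.
Qed.

Lemma computable_pred {A} `{coded A} (f : A -> nat) :
  computable f -> computable (fun a => (f a).-1).
Proof.
move=> cf; apply: (@computable_ext _ _ _ _
  (fun a => (iter (f a) (fun x => (x.2, x.2.+1)) (0, 0)).1)).
  move=> a; have -> : iter (f a) (fun x => (x.2, x.2.+1)) (0, 0)
    = ((f a).-1, f a) by elim: (f a) => //= n ->.
  by [].
apply: computable_fst; apply: (computable_iter (B := (nat * nat)%type)) => //.
  by apply: computable_pair; exact: computable_const.
have c2 : computable (fun p : A * (nat * nat) => p.2.2).
  by do 2 apply: computable_snd; exact: computable_id.
by apply: computable_pair => //; exact: computable_succ.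
Qed.

Lemma computable_sub {A} `{coded A} (f g : A -> nat) :
  computable f -> computable g -> computable (fun a => f a - g a).
Proof.
move=> cf cg; apply: (@computable_ext _ _ _ _
  (fun a => iter (g a) predn (f a))).
  by move=> a; elim: (g a) => [|n] /=; rewrite ?subn0 // => ->; rewrite subnS.
apply: computable_iter => //.
by apply: computable_pred; apply: computable_snd; exact: computable_id.
Qed.

Lemma computable_mul {A} `{coded A} (f g : A -> nat) :
  computable f -> computable g -> computable (fun a => f a * g a).
Proof.
move=> cf cg; apply: (@computable_ext _ _ _ _
  (fun a => iter (f a) (fun x => g a + x) 0)).
  by move=> a; elim: (f a) => [|n] //= ->; rewrite mulSn.
apply: computable_iter => //; first exact: computable_const.
apply: computable_add; last by apply: computable_snd; exact: computable_id.
by apply: computable_comp cg _; apply: computable_fst; exact: computable_id.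
Qed.

Lemma computable_exp {A} `{coded A} (f g : A -> nat) :
  computable f -> computable g -> computable (fun a => f a ^ g a).
Proof.
move=> cf cg; apply: (@computable_ext _ _ _ _
  (fun a => iter (g a) (fun x => f a * x) 1)).
  by move=> a; elim: (g a) => [|n] //= ->; rewrite expnS.
apply: computable_iter => //; first exact: computable_const.
apply: computable_mul; last by apply: computable_snd; exact: computable_id.
by apply: computable_comp cf _; apply: computable_fst; exact: computable_id.
Qed.

Lemma computable_if0 {A B} `{coded A} `{coded B} (f : A -> nat) (g h : A -> B) :
  computable f -> computable g -> computable h ->
  computable (fun a => if f a == 0 then g a else h a).
Proof.
move=> cf cg ch; apply: (@computable_ext _ _ _ _
  (fun a => iter (f a) (fun=> h a) (g a))).
  by move=> a; case: (f a).
apply: computable_iter => //.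
by apply: computable_comp ch _; apply: computable_fst; exact: computable_id.
Qed.

Lemma computable_if_eq {A B} `{coded A} `{coded B} (f f' : A -> nat)
  (g h : A -> B) :
  computable f -> computable f' -> computable g -> computable h ->
  computable (fun a => if f a == f' a then g a else h a).
Proof.
move=> cf cf' cg ch; apply: (@computable_ext _ _ _ _
  (fun a => if (f a - f' a) + (f' a - f a) == 0 then g a else h a)).
  by move=> a; congr (if _ then _ else _); rewrite addn_eq0 !subn_eq0 eqn_leq.
by apply: computable_if0 => //; apply: computable_add; apply: computable_sub.
Qed.

Lemma computable_div {A} `{coded A} (f g : A -> nat) :
  computable f -> computable g -> computable (fun a => f a %/ g a).
Proof.
(* The least q with f < (q + 1) * g; the last factor stops the search at 0 when g = 0, in agreement
   with [x %/ 0 = 0]. *)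
move=> cf cg; apply: (computable_mu (g := fun p : nat * A =>
  ((f p.2).+1 - p.1.+1 * g p.2) * g p.2)).
- have c1 : computable (fun p : nat * A => g p.2).
    by apply: computable_comp cg _; apply: computable_snd; exact: computable_id.
  apply: computable_mul => //; apply: computable_sub.
    apply: computable_succ; apply: computable_comp cf _.
    by apply: computable_snd; exact: computable_id.
  apply: computable_mul => //; apply: computable_succ.
  by apply: computable_fst; exact: computable_id.
- move=> a /=; case: (posnP (g a)) => [->|g0]; first by rewrite muln0.
  apply/eqP; rewrite muln_eq0 subn_eq0 -ltnS ltnS.
  by rewrite ltn_ceil.
- move=> a m /=; case: (posnP (g a)) => [->|g0]; first by rewrite divn0.
  move=> lt; rewrite muln_eq0 negb_or -lt0n subn_gt0 ltnS -lt0n g0 andbT.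
  by rewrite -leq_divRL.
Qed.

Lemma computable_mod {A} `{coded A} (f g : A -> nat) :
  computable f -> computable g -> computable (fun a => f a %% g a).
Proof.
move=> cf cg; apply: (@computable_ext _ _ _ _
  (fun a => f a - f a %/ g a * g a)).
  by move=> a; rewrite {1}(divn_eq (f a) (g a)) addKn.
by apply: computable_sub => //; apply: computable_mul => //; exact: computable_div.
Qed.

Lemma computable_log2 {A} `{coded A} (f : A -> nat) :
  computable f -> computable (fun a => logn 2 (f a)).
Proof.
(* The least k such that 2^(k+1) does not divide f; the last factor covers f = 0, where [logn] is
   0. *)
move=> cf; apply: (computable_mu (g := fun p : nat * A =>
  (1 - f p.2 %% 2 ^ p.1.+1) * f p.2)).
- have c1 : computable (fun p : nat * A => f p.2).
    by apply: computable_comp cf _; apply: computable_snd; exact: computable_id.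
  apply: computable_mul => //; apply: computable_sub; first exact: computable_const.
  apply: computable_mod => //; apply: computable_exp; first exact: computable_const.
  by apply: computable_succ; apply: computable_fst; exact: computable_id.
- move=> a /=; case: (posnP (f a)) => [->|f0]; first by rewrite muln0.
  by apply/eqP; rewrite muln_eq0 subn_eq0 lt0n -/(dvdn _ _) pfactor_dvdn // ltnn.
- move=> a m /=; case: (posnP (f a)) => [->|f0]; first by rewrite logn0.
  move=> lt; rewrite muln_eq0 negb_or -!lt0n f0 andbT subn_gt0 ltnS leqn0.
  by rewrite -/(dvdn _ _) pfactor_dvdn.
Qed.

(** [F] is arbitrary: a finite table is a chain of comparisons. This is how the codes enter the
    decoders without any uniformity. *)
Lemma computable_finite_support {A : eqType} `{coded A} (l : seq A) (F : A -> nat) :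
  injective (ncode : A -> nat) ->
  computable (fun a => if a \in l then F a else 0).
Proof.
move=> inj; elim: l => [|b l IH]; first exact: computable_const.
apply: (@computable_ext _ _ _ _
  (fun a => if ncode a == ncode b then F b else if a \in l then F a else 0)).
  move=> a; rewrite inE; case: eqP => [/inj ->|ne]; first by rewrite eqxx.
  by case: eqP => // e; case: ne; rewrite e.
apply: computable_if_eq => //; try exact: computable_const.
by exists PId => a; constructor.
Qed.

Lemma code_prod_inj A B `{coded A} `{coded B} :
  injective (ncode : A -> nat) -> injective (ncode : B -> nat) ->
  injective (ncode : A * B -> nat).
Proof. by move=> iA iB [a b] [a' b'] /cpair_inj[/iA /= -> /iB /= ->]. Qed.

(** * Strings as numbers, and a prefix-free encoding of payloads *)

(* Little-endian value, so that [(benc s).+1] is the value of [s] followed by a leading 1. *)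
Fixpoint bval (s : seq bool) : nat := if s is b :: t then b + (bval t).*2 else 0.

Lemma benc_bval s : (benc s).+1 = bval s + 2 ^ size s.
Proof.
by elim: s => //= b t; rewrite expnS; lia.
Qed.

Lemma bval_lt s : bval s < 2 ^ size s.
Proof. by elim: s => //= b t IH; rewrite expnS mul2n -!muln2; case: b; lia. Qed.

Lemma bval_cat s t : bval (s ++ t) = bval s + 2 ^ size s * bval t.
Proof.
elim: s => [|b s IH] /=; first by rewrite mul1n.
by rewrite IH doubleD expnS -!muln2; ring.
Qed.

Lemma bval_nseq_true k : (bval (nseq k true)).+1 = 2 ^ k.
Proof. by elim: k => //= k IH; rewrite expnS -IH -muln2; lia. Qed.

Lemma bval_nseq_false k : bval (nseq k false) = 0.
Proof. by elim: k => //= k ->. Qed.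

Lemma bval_surj k v : v < 2 ^ k -> exists s, size s = k /\ bval s = v.
Proof.
elim: k v => [|k IH] v; first by rewrite expn0; case: v => // _; exists [::].
rewrite expnS => lt; have [|s [ss sv]] := IH (v./2); first by lia.
by exists (odd v :: s); rewrite /= ss sv odd_double_half.
Qed.

Lemma bval_inj s t : size s = size t -> bval s = bval t -> s = t.
Proof.
elim: s t => [|b s IH] [|c t] //= [/IH {}IH] e.
have eb : b = c by have := congr1 odd e; rewrite !oddD !odd_double !addbF !oddb.
by subst; congr (_ :: _); apply: IH; move: e => /addnI; lia.
Qed.

Lemma benc_inj : injective benc.
Proof.
move=> s t e; have e1 := benc_bval s; have e2 := benc_bval t.
have := bval_lt s; have := bval_lt t; rewrite e e2 in e1 => lt ls.
have es : size s = size t.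
  apply/eqP; rewrite eqn_leq; apply/andP; split; rewrite leqNgt; apply/negP.
    move=> h; have : 2 ^ (size t).+1 <= 2 ^ size s by rewrite leq_exp2l.
    by rewrite expnS; lia.
  move=> h; have : 2 ^ (size s).+1 <= 2 ^ size t by rewrite leq_exp2l.
  by rewrite expnS; lia.
by apply: bval_inj => //; move: e1; rewrite es; lia.
Qed.

(** Pairs as positive numbers, [k] being the 2-adic valuation. In binary this is a unary tag of
    [k + 1] digits followed by [a]; 0 stays free as an end mark. *)
Definition mark k a := 2 ^ k * (2 * a).+1.

Lemma mark_gt0 k a : 0 < mark k a.
Proof. by rewrite muln_gt0 expn_gt0. Qed.

Lemma logn_mark k a : logn 2 (mark k a) = k.
Proof.
rewrite lognM ?expn_gt0 // pfactorK // logn_coprime ?addn0 //.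
by rewrite coprime2n /= mul2n odd_double.
Qed.

Lemma div_mark k a : mark k a %/ 2 ^ k.+1 = a.
Proof. by rewrite /mark expnS mulnC divnMr ?expn_gt0 //; lia. Qed.

Lemma mark_surj n : 0 < n -> n = mark (logn 2 n) (n %/ 2 ^ (logn 2 n).+1).
Proof.
move=> n0; have [m m2 e] := pfactor_coprime (p := 2) isT n0.
rewrite {1 3}e expnS divnMr ?expn_gt0 //.
rewrite /mark mulnC; congr (_ * _).
by move: m2; rewrite coprime2n => m2; lia.
Qed.

Lemma computable_marked {A} `{coded A} (f : A -> nat) : computable f ->
  computable (fun a => f a %/ 2 ^ (logn 2 (f a)).+1).
Proof.
move=> cf; apply: computable_div => //; apply: computable_exp.
  exact: computable_const.
by apply: computable_succ; exact: computable_log2.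
Qed.

(** Adding 1 carries through the initial ones, so the unary header becomes the 2-adic valuation. *)
Lemma benc_block k b :
  (benc (nseq k true ++ false :: b)).+2 = mark k (2 ^ size b + bval b).
Proof.
rewrite benc_bval bval_cat size_cat size_nseq /= add0n expnD expnS.
have := bval_nseq_true k; rewrite /mark -mul2n => <-.
by set x := bval _; ring.
Qed.

Lemma prefix_block k k' b b' t : size b = t * k -> size b' = t * k' ->
  prefix (nseq k true ++ false :: b) (nseq k' true ++ false :: b') ->
  nseq k true ++ false :: b = nseq k' true ++ false :: b'.
Proof.
move=> sb sb' h.
have idx j c : index false (nseq j true ++ false :: c) = j.
  by elim: j => //= j ->.
have ek : k = k'.
  move: h => /prefixP[s e]; rewrite -(idx k' b') e -catA /=.
  by rewrite (idx k (b ++ s)).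
have es : size (nseq k true ++ false :: b) = size (nseq k' true ++ false :: b').
  by rewrite !size_cat !size_nseq /= sb sb' ek.
by move: h; rewrite prefixE es take_size eq_sym => /eqP.
Qed.

(** Asks for an actual description, whereas the infimum in [KU] would be 0 on an empty set. *)
Definition kol_le (U : prcode) (sigma : seq bool) (n : nat) :=
  exists p, describes U p sigma /\ size p <= n.

(* A payload [V < 2 ^ (t * k)] is written as [1^k 0 b] with [b] the [t * k] low bits of [V]. *)
Lemma padded_machine (G : prcode) (t : nat) : exists M, prefix_free_machine M /\
  forall V k y, peval G V y -> V < 2 ^ (t * k) ->
    exists p, peval M (benc p) y /\ size p = t * k + k + 1.
Proof.
pose lg (x : nat) := logn 2 x.+2.
pose rest (x : nat) := x.+2 %/ 2 ^ (logn 2 x.+2).+1.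
(* On a well-formed input the only zero is the payload; on any other input the value is 1
   throughout, so the search diverges and the domain stays prefix-free. *)
pose test (p : nat * nat) := if rest p.2 %/ 2 ^ (t * lg p.2) == 1 then
  (p.1 - rest p.2 %% 2 ^ (t * lg p.2)) + (rest p.2 %% 2 ^ (t * lg p.2) - p.1)
  else 1.
have cid : computable (fun p : nat * nat => p.2.+2).
  by do 2 apply: computable_succ; apply: computable_snd; exact: computable_id.
have crest : computable (fun p : nat * nat => rest p.2) by exact: computable_marked.
have cpow : computable (fun p : nat * nat => 2 ^ (t * lg p.2)).
  apply: computable_exp; first exact: computable_const.
  by apply: computable_mul; [exact: computable_const|exact: computable_log2].
have c1 : computable (fun p : nat * nat => p.1).
  by apply: computable_fst; exact: computable_id.
have cmod : computable (fun p : nat * nat => rest p.2 %% 2 ^ (t * lg p.2)).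
  exact: computable_mod.
have [T hT] : computable test.
  apply: computable_if_eq; try exact: computable_const.
    exact: computable_div.
  by apply: computable_add; exact: computable_sub.
have evT n x : peval T (cpair n x) (test (n, x)) by exact: hT (n, x).
exists (PComp G (PMu T)); split.
- have wf x y : peval (PComp G (PMu T)) (benc x) y ->
      exists k b, x = nseq k true ++ false :: b /\ size b = t * k.
    move=> h; inversion h as [| | | | |? ? ? n ? hn _| | | |]; subst.
    inversion hn as [| | | | | | | | |? ? ? h0 _]; subst.
    have := peval_det h0 (evT _ _); rewrite /test /=; case: eqP => // e _.
    have lt : rest (benc x) %% 2 ^ (t * lg (benc x)) < 2 ^ (t * lg (benc x)).
      by rewrite ltn_pmod // expn_gt0.
    have [b [sb vb]] := bval_surj lt.
    exists (lg (benc x)), b; split=> //; apply: benc_inj.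
    have := benc_block (lg (benc x)) b; rewrite sb vb.
    have := divn_eq (rest (benc x)) (2 ^ (t * lg (benc x))).
    rewrite e mul1n => <-.
    by rewrite -mark_surj // => -[].
  move=> p q y z /wf[k [b [-> sb]]] /wf[k' [b' [-> sb']]].
  exact: prefix_block sb sb'.
- move=> V k y hG lt; have [b [sb vb]] := bval_surj lt.
  exists (nseq k true ++ false :: b); split; last first.
    by rewrite size_cat size_nseq /= sb; lia.
  apply: ev_comp (hG).
  have eb := benc_block k b; rewrite sb vb in eb.
  have elg : lg (benc (nseq k true ++ false :: b)) = k by rewrite /lg eb logn_mark.
  have er : rest (benc (nseq k true ++ false :: b)) = 2 ^ (t * k) + V.
    by rewrite /rest eb logn_mark div_mark.
  have et n : test (n, benc (nseq k true ++ false :: b)) = (n - V) + (V - n).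
    rewrite /test elg er /= divnDl // divnn expn_gt0 /= divn_small // addn0 eqxx.
    by rewrite modnDl modn_small.
  apply: ev_mu; first by have := evT V (benc (nseq k true ++ false :: b)); rewrite et subnn.
  move=> m lm; eexists; split; last exact: evT.
  by rewrite et; apply/eqP; rewrite addn_eq0 !subn_eq0; lia.
Qed.

(** With [t * k] close to the length of the payload, the header costs a fraction 1/t of it. The
    constant depends on [G] and [t], but not on the payload. *)
Lemma kol_le_payload U (hU : optimal_pf_machine U) (G : prcode) (t : nat) :
  exists c, forall V k sigma, peval G V (benc sigma) -> V < 2 ^ (t * k) ->
    kol_le U sigma (t * k + k + c).
Proof.
have [M [pfM hM]] := padded_machine G t; have [c hc] := hU.2 M pfM.
exists c.+1 => V k sigma hG lt; have [p [hp sp]] := hM V k _ hG lt.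
by have [q [hq sq]] := hc _ _ hp; exists q; split=> //; lia.
Qed.

(** * Decoding a sequence of blocks *)

Notation dstate := (nat * (nat * (nat * nat)))%type.

(* State [(v, x, w, e)]: remaining code, remaining side information, value [w]
   of the output so far and [e = 2 ^ (its length)]; [v = 0] is the end mark. *)
Definition dstep (P B : nat -> nat) (T : nat * (nat * nat) -> nat)
    (st : dstate) : dstate :=
  let: (v, (x, (w, e))) := st in
  let c := logn 2 v in
  let r := v %/ 2 ^ c.+1 in
  if v == 0 then st else
  (r %/ B c, (x %/ P c, (w + e * T (c, (x %% P c, r %% B c)), e * P c))).

Lemma computable_dstep P B T :
  computable P -> computable B -> computable T -> computable (dstep P B T).
Proof.
move=> cP cB cT.
pose V (st : dstate) := st.1.
pose X (st : dstate) := st.2.1.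
pose W (st : dstate) := st.2.2.1.
pose E (st : dstate) := st.2.2.2.
have cid : computable (fun st : dstate => st) by exact: computable_id.
have cV : computable V by exact: computable_fst.
have cX : computable X by apply: computable_fst; exact: computable_snd.
have cW : computable W by apply: computable_fst; do 2 apply: computable_snd.
have cE : computable E by do 3 apply: computable_snd.
have cL : computable (fun st => logn 2 (V st)) by exact: computable_log2.
have cR : computable (fun st => V st %/ 2 ^ (logn 2 (V st)).+1).
  exact: computable_marked.
have cPc : computable (fun st => P (logn 2 (V st))).
  exact: (computable_comp cP cL).
have cBc : computable (fun st => B (logn 2 (V st))).
  exact: (computable_comp cB cL).
apply: (@computable_ext _ _ _ _ (fun st => if V st == 0 then st else
  (V st %/ 2 ^ (logn 2 (V st)).+1 %/ B (logn 2 (V st)),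
   (X st %/ P (logn 2 (V st)),
   (W st + E st * T (logn 2 (V st), (X st %% P (logn 2 (V st)),
      V st %/ 2 ^ (logn 2 (V st)).+1 %% B (logn 2 (V st)))),
    E st * P (logn 2 (V st))))))).
  by case=> [v [x [w e]]].
apply: computable_if0 => //.
apply: computable_pair; first exact: computable_div.
apply: computable_pair; first exact: computable_div.
apply: computable_pair; last exact: computable_mul.
apply: computable_add => //; apply: computable_mul => //.
apply: (computable_comp cT); apply: computable_pair => //.
by apply: computable_pair; exact: computable_mod.
Qed.

(** The code itself serves as fuel, since each step decreases it until it is 0. The final
    predecessor turns value plus 2^length into [benc]. *)
Definition dec P B T (vx : nat * nat) : nat :=
  let st := iter vx.1 (dstep P B T) (vx.1, (vx.2, (0, 1))) in
  (st.2.2.1 + st.2.2.2).-1.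

Lemma computable_dec P B T :
  computable P -> computable B -> computable T -> computable (dec P B T).
Proof.
move=> cP cB cT.
have cid : computable (fun st : nat * nat => st) by exact: computable_id.
have cit : computable (fun vx : nat * nat =>
    iter vx.1 (dstep P B T) (vx.1, (vx.2, (0, 1)))).
  apply: (computable_iter (g := fun _ => dstep P B T)).
  - exact: computable_fst.
  - apply: computable_pair; first exact: computable_fst.
    apply: computable_pair; first exact: computable_snd.
    by apply: computable_pair; exact: computable_const.
  - apply: computable_comp; first exact: computable_dstep.
    by apply: computable_snd; exact: computable_id.
apply: computable_pred; apply: computable_add.
  by apply: computable_fst; do 2 apply: computable_snd.
by do 3 apply: computable_snd.
Qed.

Fixpoint bits k v : seq bool := if k is k'.+1 then odd v :: bits k' v./2 else [::].

Lemma bits_bval s : bits (size s) (bval s) = s.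
Proof.
elim: s => //= b s IH; rewrite oddD odd_double addbF oddb; congr (_ :: _).
by rewrite half_bit_double.
Qed.

(* A block [(c, x, y)] of class [c]: [y] has length [mm c] and is one of the
   [2 ^ beta c] strings that [lst c] lists for the side information [x]. *)
Definition block := (nat * (seq bool * seq bool))%type.
Definition bx (b : block) := b.2.1.
Definition by_ (b : block) := b.2.2.

Definition vblock (mm beta : nat -> nat) (lst : nat -> seq bool -> seq (seq bool))
    (C : nat) (b : block) :=
  [&& b.1 < C, size (bx b) == mm b.1, size (by_ b) == mm b.1,
      by_ b \in lst b.1 (bx b) & size (lst b.1 (bx b)) <= 2 ^ beta b.1].

Definition bcost (beta : nat -> nat) (b : block) := b.1 + 1 + beta b.1.

Lemma iter_dstep0 P B T n s : iter n (dstep P B T) (0, s) = (0, s).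
Proof. by elim: n => //= n ->; case: s => x [w e]. Qed.

(** The number [x] is what remains of the side information after the last block: 0 if there is none,
    1 if it comes from [benc], which amounts to a leading 1. *)
Lemma decode_blocks mm beta lst C (P B : nat -> nat) T (bs : seq block) :
  (forall c, c < C -> P c = 2 ^ mm c) -> (forall c, c < C -> B c = 2 ^ beta c) ->
  (forall c x i, c < C -> size x = mm c -> i < 2 ^ beta c ->
     T (c, (bval x, i)) = bval (nth [::] (lst c x) i)) ->
  all (vblock mm beta lst C) bs ->
  exists v, v < 2 ^ (\sum_(b <- bs) bcost beta b) /\
    forall n x w e, v <= n -> iter n (dstep P B T)
       (v, (bval (flatten (map bx bs)) + 2 ^ size (flatten (map bx bs)) * x, (w, e)))
    = (0, (x, (w + e * bval (flatten (map by_ bs)),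
               e * 2 ^ size (flatten (map by_ bs))))).
Proof.
move=> hP hB hT; elim: bs => [_|[c [x y]] bs IH] /=.
  exists 0; rewrite big_nil; split=> // n x w e _.
  by rewrite iter_dstep0 add0n mul1n muln0 addn0 muln1.
move=> /andP[/and5P[/= cC /eqP sx /eqP sy yl sl] hbs].
rewrite /bx /by_ /= in sx sy yl sl *.
have [v' [lv' hv']] := IH hbs.
set i := index y (lst c x).
have li : i < 2 ^ beta c by apply: leq_trans sl; rewrite index_mem.
(* Unary class tag, index of [y] in its list on [beta c] bits, code of the other blocks: each block
   takes [c + 1 + beta c] bits, which is [bcost]. *)
exists (mark c (i + 2 ^ beta c * v')); split.
  rewrite big_cons /bcost /= /mark !expnD expn1.
  set Z := 2 ^ \sum_(_ <- _) _ in lv' *.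
  have : 2 ^ beta c * v' + 2 ^ beta c <= 2 ^ beta c * Z by rewrite -mulnSr leq_mul2l lv' orbT.
  by rewrite -!mulnA ltn_pmul2l ?expn_gt0 // => ?; lia.
move=> [|n] x0 w e; first by have := mark_gt0 c (i + 2 ^ beta c * v'); lia.
move=> ln; rewrite iterSr /dstep -/(dstep P B T) logn_mark div_mark.
have -> : (mark c (i + 2 ^ beta c * v') == 0) = false.
  by have := mark_gt0 c (i + 2 ^ beta c * v'); lia.
rewrite hP // hB // !size_cat !bval_cat sx.
set xr := flatten _; set yr := flatten _.
have -> : bval x + 2 ^ mm c * bval xr + 2 ^ (mm c + size xr) * x0 =
   (bval xr + 2 ^ size xr * x0) * 2 ^ mm c + bval x by rewrite expnD; ring.
have lx : bval x < 2 ^ mm c by rewrite -sx bval_lt.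
rewrite divnMDl ?expn_gt0 // (divn_small lx) addn0 modnMDl (modn_small lx).
rewrite [i + _]addnC [2 ^ _ * v']mulnC divnMDl ?expn_gt0 // (divn_small li) addn0.
rewrite modnMDl (modn_small li) hT // nth_index // hv'; last first.
  rewrite -ltnS; apply: leq_trans ln.
  have h1 : v' <= 2 ^ beta c * v' by rewrite leq_pmull ?expn_gt0.
  have : (2 * (i + 2 ^ beta c * v')).+1 <= mark c (i + 2 ^ beta c * v').
    by rewrite leq_pmull ?expn_gt0.
  by lia.
by rewrite sy expnD; congr (_, (_, (_, _))); ring.
Qed.

Lemma dec_blocks mm beta lst C (P B : nat -> nat) T (bs : seq block) :
  (forall c, c < C -> P c = 2 ^ mm c) -> (forall c, c < C -> B c = 2 ^ beta c) ->
  (forall c x i, c < C -> size x = mm c -> i < 2 ^ beta c ->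
     T (c, (bval x, i)) = bval (nth [::] (lst c x) i)) ->
  all (vblock mm beta lst C) bs ->
  exists v, v < 2 ^ (\sum_(b <- bs) bcost beta b) /\
    forall x, dec P B T
       (v, bval (flatten (map bx bs)) + 2 ^ size (flatten (map bx bs)) * x)
    = benc (flatten (map by_ bs)).
Proof.
move=> hP hB hT hbs; have [v [lv hv]] := decode_blocks hP hB hT hbs.
exists v; split=> // x; rewrite /dec hv //= add0n !mul1n.
by rewrite -benc_bval.
Qed.

(** Below [C] only finitely many triples of class, side information and index occur, so arbitrary
    lists give computable tables. *)
Lemma tables_computable mm beta lst C : 
  exists (P B : nat -> nat) (T : nat * (nat * nat) -> nat),
  (computable P /\ computable B /\ computable T) /\
  [/\ (forall c, c < C -> P c = 2 ^ mm c), (forall c, c < C -> B c = 2 ^ beta c) &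
   (forall c x i, c < C -> size x = mm c -> i < 2 ^ beta c ->
     T (c, (bval x, i)) = bval (nth [::] (lst c x) i))].
Proof.
pose l : seq (nat * (nat * nat)) := flatten [seq
  [seq (c, p) | p <- [seq (x, i) | x <- iota 0 (2 ^ mm c), i <- iota 0 (2 ^ beta c)]]
  | c <- iota 0 C].
pose F (p : nat * (nat * nat)) := bval (nth [::] (lst p.1 (bits (mm p.1) p.2.1)) p.2.2).
exists (fun c => if c \in iota 0 C then 2 ^ mm c else 0).
exists (fun c => if c \in iota 0 C then 2 ^ beta c else 0).
exists (fun p => if p \in l then F p else 0).
have injn : injective (ncode : nat -> nat) by [].
split; first split; last split.
- exact: (@computable_finite_support nat _ (iota 0 C) (fun c => 2 ^ mm c)).
split.
  exact: (@computable_finite_support nat _ (iota 0 C) (fun c => 2 ^ beta c)).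
  apply: (@computable_finite_support (nat * (nat * nat))%type _ l F).
  by do 2 apply: code_prod_inj => //.
- by move=> c cC; rewrite mem_iota /= add0n cC.
- by move=> c cC; rewrite mem_iota /= add0n cC.
- move=> c x i cC sx li; have -> : (c, (bval x, i)) \in l.
    apply/flattenP; eexists.
      by apply/mapP; exists c => //; rewrite mem_iota add0n.
    apply/mapP; exists (bval x, i) => //; apply/allpairsP; exists (bval x, i).
    by rewrite !mem_iota !add0n /= -sx bval_lt.
  by rewrite /F /= -sx bits_bval.
Qed.

(** Side information made of zeros has value 0 and can be supplied as a constant; [kappa] pays for
    the tables and for rounding. *)
Lemma kol_le_blocks U (hU : optimal_pf_machine U) mm beta lst C t : 0 < t ->
  exists kappa, forall bs, all (vblock mm beta lst C) bs ->
    (forall b, b \in bs -> bx b = nseq (mm b.1) false) ->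
  exists n, kol_le U (flatten (map by_ bs)) n /\
    t * n <= (t + 3) * (\sum_(b <- bs) bcost beta b) + kappa.
Proof.
move=> t0; have [P [B [T [[cP [cB cT]] [hP hB hT]]]]] := tables_computable mm beta lst C.
have [D hD] := computable_dec cP cB cT.
have [c hc] := kol_le_payload hU (PComp D (PPair PId PZero)) t.
exists ((t + 1) * t + t * c) => bs hbs h0.
have [v [lv hv]] := dec_blocks hP hB hT hbs.
set W := \sum_(b <- bs) _ in lv *.
have x0 : bval (flatten (map bx bs)) = 0.
  elim: bs h0 {hbs lv hv W} => //= b bs IH h0.
  rewrite bval_cat h0 ?mem_head // bval_nseq_false IH ?muln0 // => b' b'bs.
  by apply: h0; rewrite inE b'bs orbT.
exists (t * (W %/ t).+1 + (W %/ t).+1 + c); split.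
  apply: (hc v).
    have := hD (v, 0); have := hv 0; rewrite x0 muln0 addn0 => ->.
    by apply: ev_comp; apply: ev_pair; constructor.
  apply: leq_trans lv _; rewrite leq_exp2l //.
  by rewrite mulnC; exact/ltnW/ltn_ceil.
have := divn_eq W t; have := ltn_pmod W t0.
set q := W %/ t; set r := W %% t => lr ->; nia.
Qed.

Lemma kol_le_blocks_cond U (hU : optimal_pf_machine U) mm beta lst C t : 0 < t ->
  exists kappa, forall bs, all (vblock mm beta lst C) bs ->
  forall K, kol_le U (flatten (map bx bs)) K ->
  exists n, kol_le U (flatten (map by_ bs)) n /\
    t * n <= (t + 3) * (K + \sum_(b <- bs) bcost beta b) + kappa.
Proof.
move=> t0; have [P [B [T [[cP [cB cT]] [hP hB hT]]]]] := tables_computable mm beta lst C.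
have [D hD] := computable_dec cP cB cT.
pose rest V := V %/ 2 ^ (logn 2 V).+1.
have cid : computable (fun n : nat => n) by exact: computable_id.
have crest : computable rest by exact: (computable_marked cid).
have cpow : computable (fun V => 2 ^ (t * logn 2 V)).
  apply: computable_exp; first exact: computable_const.
  apply: computable_mul; first exact: computable_const.
  exact: (computable_log2 cid).
have [Vc hVc] := computable_div crest cpow.
have [Pc hPc] := computable_mod crest cpow.
have [c hc] := kol_le_payload hU
  (PComp D (PPair Vc (PComp PSucc (PComp U Pc)))) t.
exists ((t + 3) * (2 * t + 4) + t * c) => bs hbs K [p [hp sp]].
have [v [lv hv]] := dec_blocks hP hB hT hbs.
set W := \sum_(b <- bs) _ in lv *.
pose h := ((size p).+1 %/ t).+1.
have lh : (size p).+1 <= t * h by rewrite mulnC; exact/ltnW/ltn_ceil.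
have lp : benc p < 2 ^ (t * h).
  apply: (@leq_trans (2 ^ (size p).+1)); last by rewrite leq_exp2l.
  by rewrite benc_bval expnS; have := bval_lt p; lia.
(* Two self-delimiting layers: the tag [h] tells that the low [t * h] bits hold [p], and the rest is
   the block code. The decoder has [U] built in and runs it on [p] to recover the side
   information. *)
pose V := mark h (v * 2 ^ (t * h) + benc p).
pose L := h + 1 + t * h + W.
have lV : V < 2 ^ L.
  rewrite /V /L /mark !expnD expn1 -!mulnA ltn_pmul2l ?expn_gt0 //.
  have : v * 2 ^ (t * h) + 2 ^ (t * h) <= 2 ^ (t * h) * 2 ^ W.
    by rewrite addnC -mulSn mulnC leq_mul2l lv orbT.
  by lia.
exists (t * (L %/ t).+1 + (L %/ t).+1 + c); split.
  apply: (hc V); last first.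
    apply: leq_trans lV _; rewrite leq_exp2l //.
    by rewrite mulnC; exact/ltnW/ltn_ceil.
  have rV : rest V = v * 2 ^ (t * h) + benc p by rewrite /rest logn_mark div_mark.
  have := hD (v, (benc (flatten (map bx bs))).+1).
  have := hv 1; rewrite muln1 benc_bval => -> hD'.
  apply: ev_comp hD'; apply: ev_pair.
    have := hVc V; rewrite rV logn_mark divnMDl ?expn_gt0 //.
    by rewrite (divn_small lp) addn0.
  have := hPc V; rewrite rV logn_mark modnMDl (modn_small lp) => hP'.
  apply: ev_comp; first by apply: ev_comp; [exact: hP'|exact: hp].
  by rewrite -benc_bval; exact: ev_succ.
have l1 : t * (L %/ t).+1 <= L + t.
  by have := leq_divM L t; rewrite mulnC mulnS; lia.
have l2 : t * h <= K + 1 + t.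
  by have := leq_divM (size p).+1 t; rewrite /h mulnC mulnS; lia.
have l3 : t * (t * (L %/ t).+1 + (L %/ t).+1 + c) <= (t + 1) * (L + t) + t * c.
  by move: l1; nia.
apply: (leq_trans l3); rewrite addnA leq_add2r /L.
(* The inner header [h] adds 2 to the factor [t + 1] due to the outer one; this is the origin of
   [t + 3]. *)
have : (t + 1) * h <= 2 * (K + 1 + t) by nia.
nia.
Qed.

(** * Greedy covering and balanced assignment *)

Lemma sum_exists_ge (I : finType) (F : I -> nat) (a : nat) :
  0 < #|I| -> a <= \sum_i F i -> exists i, a <= #|I| * F i.
Proof.
move=> I0 h; apply: contrapT => /forallNP hn.
have : \sum_i #|I| * F i < #|I| * a.
  rewrite -[X in _ < X * _]sum1_card big_distrl /=.
  have [i0 _] := card_gt0P I0.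
  rewrite (bigD1 i0) //= [X in _ < X](bigD1 i0) //= -addSn leq_add //.
    by rewrite mul1n ltnNge; apply/negP; exact: hn.
  by apply: leq_sum => i _; rewrite mul1n ltnW // ltnNge; apply/negP; exact: hn.
by rewrite -big_distrr /= ltn_mul2l I0 /= ltnNge h.
Qed.

Lemma double_count (I J : finType) (e : I -> J -> bool) :
  \sum_i #|[set j | e i j]| = \sum_j #|[set i | e i j]|.
Proof.
under eq_bigr do rewrite -sum1dep_card big_mkcond /=.
under [RHS]eq_bigr do rewrite -sum1dep_card big_mkcond /=.
exact: exchange_big.
Qed.

(** By double counting, the average centre covers a proportion of at least V/|T| of [W]. *)
Lemma greedy_cover_step (T : finType) (e : T -> T -> bool) (V : nat) (W : {set T}) :
  0 < #|T| -> (forall y, V <= #|[set c | e c y]|) ->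
  exists c, #|[set y in W | ~~ e c y]| * #|T| <= #|W| * (#|T| - V).
Proof.
move=> T0 hV.
have [|c hc] := @sum_exists_ge T (fun c => #|[set y in W | e c y]|) (#|W| * V) T0.
  rewrite (double_count (fun c y => (y \in W) && e c y)).
  rewrite (bigID (mem W)) /= -[X in X <= _]addn0 leq_add //.
  rewrite -sum_nat_const leq_sum // => y yW.
  by apply: leq_trans (hV y) _; rewrite subset_leq_card //; apply/fintype.subsetP => c; rewrite !inE yW.
exists c.
have e1 : #|W| = #|[set y in W | e c y]| + #|[set y in W | ~~ e c y]|.
  rewrite -(cardsID [set y | e c y] W); congr (_ + _); apply: eq_card => y.
    by rewrite !inE andbC.
  by rewrite !inE andbC.
by rewrite mulnBr; nia.
Qed.

Lemma greedy_cover (T : finType) (e : T -> T -> bool) (V t : nat) :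
  0 < #|T| -> (forall y, V <= #|[set c | e c y]|) ->
  exists C : {set T}, #|C| <= t /\
    #|[set y | [forall c in C, ~~ e c y]]| * #|T| ^ t <= #|T| * (#|T| - V) ^ t.
Proof.
move=> T0 hV; elim: t => [|t [C [sC hC]]].
  exists finset.set0; rewrite cards0 !expn0 !muln1; split=> //; exact: max_card.
have [c hc] := greedy_cover_step [set y | [forall c in C, ~~ e c y]] T0 hV.
exists (c |: C); split.
  by rewrite cardsU1; case: (c \notin C); rewrite ?add1n ?add0n ?ltnS // leqW.
set W := [set y | _] in hC hc.
have -> : [set y | [forall c0 in c |: C, ~~ e c0 y]] = [set y in W | ~~ e c y].
  apply/setP => y; rewrite !inE; apply/forall_inP/andP => [h|[/forall_inP h1 h2] d].
    split; last by apply: h; rewrite !inE eqxx.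
    by apply/forall_inP => d dC; apply: h; rewrite !inE dC orbT.
  by rewrite !inE => /orP[/eqP ->|/h1].
rewrite expnS mulnA.
apply: leq_trans (leq_mul hc (leqnn _)) _.
by have := leq_mul (leqnn (#|T| - V)) hC; rewrite expnS; nia.
Qed.

(* Take [f] minimising the sum of the squares of the fibre sizes: the fibre of [f y]
   then exceeds that of any other neighbour of [y] by at most 1.  Counting edges, the
   number of fibres of size at least [t] is halved at each step once [2 * l <= t]. *)
Lemma balanced_assignment (T X : finType) (D : {set T}) (e : X -> T -> bool)
    (Dx Dy l N : nat) :
  0 < l -> 0 < Dy -> Dx <= l * Dy -> #|X| < 2 ^ N ->
  (forall y, y \in D -> Dy <= #|[set x | e x y]|) ->
  (forall x, #|[set y in D | e x y]| <= Dx) -> (exists x : X, True) ->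
  exists f : T -> X, (forall y, y \in D -> e (f y) y) /\
    forall x, #|[set y in D | f y == x]| < 2 * l + N.
Proof.
move=> l0 Dy0 lD lX hDy hDx [x0 _].
pose ok (f : {ffun T -> X}) := [forall y in D, e (f y) y].
pose fib (f : {ffun T -> X}) x := #|[set y in D | f y == x]|.
pose Phi f := \sum_x fib f x ^ 2.
pose f0 := [ffun y => odflt x0 [pick x | e x y]].
have ok0 : ok f0.
  apply/forall_inP => y yD; rewrite ffunE; case: pickP => //= h.
  have := hDy y yD; have -> : [set x | e x y] = finset.set0.
    by apply/setP => x; rewrite !inE h.
  by rewrite cards0 leqn0; lia.
case: (arg_minnP Phi ok0) => f okf minf.
exists f; split; first by move=> y yD; exact: (forall_inP okf).
have loc y x' : y \in D -> e x' y -> fib f (f y) <= (fib f x').+1.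
  move=> yD exy; case: (eqVneq x' (f y)) => [->|ne]; first exact: leqnSn.
  pose g := [ffun z => if z == y then x' else f z].
  have okg : ok g.
    apply/forall_inP => z zD; rewrite ffunE; case: eqP => [->|_] //.
    exact: (forall_inP okf).
  have := minf g okg.
  have gx' : fib g x' = (fib f x').+1.
    rewrite /fib (_ : [set _ in D | g _ == _] = y |: [set z in D | f z == x']).
      by rewrite cardsU1 !inE yD eq_sym (negbTE ne).
    apply/setP => z; rewrite !inE ffunE; case: (eqVneq z y) => [->|] //=.
    by rewrite yD eqxx.
  have gy : fib f (f y) = (fib g (f y)).+1.
    rewrite /fib (_ : [set z in D | f z == f y] = y |: [set z in D | g z == f y]).
      by rewrite cardsU1 !inE ffunE eqxx (negbTE ne) andbF.
    apply/setP => z; rewrite !inE ffunE; case: (eqVneq z y) => [->|] //=.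
    by rewrite yD eqxx.
  have go x : x != x' -> x != f y -> fib g x = fib f x.
    move=> n1 n2; rewrite /fib; apply: eq_card => z; rewrite !inE ffunE.
    case: (eqVneq z y) => [->|] //=.
    by rewrite eq_sym (negbTE n1) eq_sym (negbTE n2).
  have ePhi h : Phi h = fib h x' ^ 2 + (fib h (f y) ^ 2 +
      \sum_(x | (x != x') && (x != f y)) fib h x ^ 2).
    by rewrite /Phi (bigD1 x') //= (bigD1 (f y)) //= eq_sym.
  (* Moving [y] to [x'] changes the sum of squares by 2 * (fib f x' + 1 - fib f (f y)), which is
     nonnegative by minimality. *)
  rewrite !ePhi.
  have -> : \sum_(x | (x != x') && (x != f y)) fib g x ^ 2 =
            \sum_(x | (x != x') && (x != f y)) fib f x ^ 2.
    by apply: eq_bigr => x /andP[n1 n2]; rewrite go.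
  by rewrite gx' gy -!mulnn; nia.
pose L t := [set x | t <= fib f x].
(* By [loc], a point assigned to [L t.+1] has all its neighbours in [L t]; these edges are counted
   from both sides. *)
have step t : t.+1 * #|L t.+1| <= l * #|L t|.
  rewrite -(leq_pmul2r Dy0).
  have h1 : t.+1 * #|L t.+1| <= #|[set y in D | f y \in L t.+1]|.
    rewrite -[X in _ <= X]sum1dep_card.
    rewrite (partition_big f (mem (L t.+1))) /=; last by move=> y /andP[].
    rewrite mulnC -sum_nat_const; apply: leq_sum => x xL.
    have := xL; rewrite inE => /leq_trans; apply.
    rewrite /fib -sum1dep_card; apply: eq_leq; apply: eq_bigl => y.
    by case: eqP => [->|]; rewrite ?andbF // xL !andbT.
  apply: (@leq_trans (\sum_(y in [set y in D | f y \in L t.+1]) Dy)).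
    by rewrite sum_nat_const leq_mul2r h1 orbT.
  apply: (@leq_trans (\sum_(x in L t) #|[set y in D | e x y]|)); last first.
    apply: (@leq_trans (\sum_(x in L t) Dx)); first by apply: leq_sum => x _.
    by rewrite sum_nat_const; nia.
  apply: (@leq_trans (\sum_y #|[set x | (x \in L t) && ((y \in D) && e x y)]|)).
    rewrite [X in _ <= X](bigID (mem [set y in D | f y \in L t.+1])) /= -[X in X <= _]addn0.
    rewrite leq_add // leq_sum // => y; rewrite inE => /andP[yD fyL].
    apply: leq_trans (hDy y yD) _; rewrite subset_leq_card //.
    apply/fintype.subsetP => x; rewrite !inE yD => exy; rewrite exy !andbT.
    by have := loc y x yD exy; move: fyL; rewrite inE; lia.
  rewrite -(double_count (fun x y => (x \in L t) && ((y \in D) && e x y))).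
  rewrite (bigID (mem (L t))) /= [X in _ + X]big1 ?addn0; last first.
    move=> x xL; apply/eqP; rewrite cards_eq0; apply/eqP/setP => y.
    by rewrite !inE in xL *; rewrite (negbTE xL).
  apply: leq_sum => x xL; apply: eq_leq; apply: eq_card => y.
  by rewrite !inE in xL *; rewrite xL.
have halve j : #|L (2 * l + j)| * 2 ^ j <= #|X|.
  elim: j => [|j IH]; first by rewrite muln1 max_card.
  apply: leq_trans IH; rewrite addnS expnS mulnA leq_mul2r; apply/orP; right.
  rewrite -(leq_pmul2l l0); apply: leq_trans (step _).
  by nia.
move=> x; rewrite ltnNge; apply/negP => h.
have := halve N; have : 0 < #|L (2 * l + N)| by apply/card_gt0P; exists x; rewrite inE.
nia.
Qed.

(** * Entropy *)

Local Open Scope ring_scope.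

(* Entropy in nats; [x * ln x = 0] at [x = 0] since [ln 0 = 0]. *)
Definition hn {R : realType} (x : R) : R := - (x * ln x) - (1 - x) * ln (1 - x).

Lemma ln2_gt0 (R : realType) : 0 < ln (2 : R).
Proof. by rewrite ln_gt0 // ltr1n. Qed.

Lemma Hbin_hn (R : realType) (x : R) : Hbin x * ln 2 = hn x.
Proof.
have xl (z : R) : xlog2x z * ln 2 = z * ln z.
  rewrite /xlog2x; case: eqP => [->|_]; first by rewrite !mul0r.
  by rewrite mulrA divfK // gt_eqF // ln2_gt0.
by rewrite /Hbin /hn mulrBl mulNr !xl.
Qed.

Lemma ln_ltB1 (R : realType) (z : R) : 0 < z -> z != 1 -> ln z < z - 1.
Proof.
move=> z0 z1; have : ln z != 0 by rewrite ln_eq0.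
by move=> /expR_gt1Dx; rewrite lnK ?posrE // ltrBrDl.
Qed.

Lemma ln_leB1 (R : realType) (z : R) : 0 < z -> ln z <= z - 1.
Proof.
move=> z0; have [->|z1] := eqVneq z 1; first by rewrite ln1 subrr.
exact/ltW/ln_ltB1.
Qed.

(** Gibbs' inequality, from ln z <= z - 1, which is strict unless z = 1. *)
Lemma hn_lt_cross (R : realType) (x y : R) : 0 < x < 1 -> 0 < y < 1 -> x != y ->
  hn x < - (x * ln y) - (1 - x) * ln (1 - y).
Proof.
move=> /andP[x0 x1] /andP[y0 y1] xy.
have x10 : 0 < 1 - x by rewrite subr_gt0.
have y10 : 0 < 1 - y by rewrite subr_gt0.
have h1 : ln y - ln x < y / x - 1.
  rewrite -ln_div ?posrE //; apply: ln_ltB1; first exact: divr_gt0.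
  by apply: contra xy => /eqP e; rewrite -[y](divfK (lt0r_neq0 x0)) e mul1r.
have h2 : ln (1 - y) - ln (1 - x) <= (1 - y) / (1 - x) - 1.
  by rewrite -ln_div ?posrE //; apply: ln_leB1; exact: divr_gt0.
have h1' : x * (ln y - ln x) < y - x.
  have := h1; rewrite -(ltr_pM2l x0) => /lt_le_trans; apply.
  by rewrite mulrBr mulr1 mulrCA divff ?lt0r_neq0 // mulr1.
have h2' : (1 - x) * (ln (1 - y) - ln (1 - x)) <= x - y.
  have := h2; rewrite -(ler_pM2l x10) => /le_trans; apply.
  by rewrite mulrBr mulr1 mulrCA divff ?lt0r_neq0 // mulr1; lra.
rewrite /hn; nra.
Qed.

(** No derivative is taken: the cross entropy with [y] is affine in its other argument, has slope ln
    (1 - y) - ln y >= 0, and equals [hn y] at [y]. *)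
Lemma hn_lt (R : realType) (x y : R) : 0 < x -> x < y -> y <= 2^-1 -> hn x < hn y.
Proof.
move=> x0 xy y2.
have y1 : y < 1 by lra.
apply: lt_le_trans (hn_lt_cross (y := y) _ _ _) _; [lra|lra|by rewrite lt_eqF|].
have : ln y <= ln (1 - y) by rewrite ler_ln ?posrE; lra.
by rewrite /hn; nra.
Qed.

Lemma hn_half (R : realType) : hn (2^-1 : R) = ln 2.
Proof.
have -> : hn (2^-1 : R) = - ln 2^-1.
  by rewrite /hn (_ : 1 - 2^-1 = 2^-1 :> R); [field|field].
by rewrite lnV ?posrE // opprK.
Qed.

Lemma hn0 (R : realType) : hn (0 : R) = 0.
Proof. by rewrite /hn subr0 ln1 mul0r mulr0 subr0 oppr0. Qed.

(** Replaces continuity at 0, so that the intermediate value theorem is applied away from 0. The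
    square brings in u * ln u, which is at least -1. *)
Lemma hn_small (R : realType) (u : R) : 0 < u <= 2^-1 -> hn (u ^+ 2) <= 3 * u.
Proof.
move=> /andP[u0 u2]; have x0 : 0 < u ^+ 2 by rewrite exprn_gt0.
have x1 : 0 < 1 - u ^+ 2 by nra.
have h1 : - ln u <= u^-1.
  by rewrite -lnV ?posrE // ltW // ln_sublinear // invr_gt0.
have h1' : - (u * ln u) <= 1.
  by have := h1; rewrite -(ler_pM2l u0) divff ?lt0r_neq0 // mulrN.
have h2 : - ln (1 - u ^+ 2) <= (1 - u ^+ 2)^-1 - 1.
  by rewrite -lnV ?posrE // ln_leB1 // invr_gt0.
have h2' : - ((1 - u ^+ 2) * ln (1 - u ^+ 2)) <= u ^+ 2.
  have := h2; rewrite -(ler_pM2l x1) mulrBr divff ?lt0r_neq0 // mulr1 mulrN; lra.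
have e : ln (u ^+ 2) = 2 * ln u by rewrite lnXn // mulr_natl.
by rewrite /hn e; nra.
Qed.

Lemma continuous_hn (R : realType) (x : R) : 0 < x < 1 -> {for x, continuous (@hn R)}.
Proof.
move=> /andP[x0 x1].
have c1 : {for x, continuous (fun y : R => 1 - y)}.
  by apply: continuousB; [exact: cvg_cst|exact: cvg_id].
have c2 : {for x, continuous (fun y : R => ln (1 - y))}.
  apply: continuous_comp => //; apply: continuous_ln; lra.
apply: continuousB.
  apply: continuousN; apply: continuousM; first exact: cvg_id.
  exact: continuous_ln.
by apply: continuousM.
Qed.

Lemma hn_surj (R : realType) (t : R) : 0 <= t <= 1 ->
  exists x : R, 0 <= x <= 2^-1 /\ hn x = t * ln 2.
Proof.
move=> /andP[t0 t1]; have l2 := ln2_gt0 R.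
have [->|tn0] := eqVneq t 0.
  by exists 0; rewrite hn0 mul0r; split=> //; lra.
have tl : 0 < t * ln 2 by rewrite mulr_gt0 // lt0r tn0.
pose u : R := Num.min 2^-1 (t * ln 2 / 3).
have u0 : 0 < u by rewrite lt_min; apply/andP; split; lra.
have u2 : u <= 2^-1 by rewrite ge_min lexx.
have u3 : u <= t * ln 2 / 3 by rewrite ge_min lexx orbT.
have hu : hn (u ^+ 2) <= t * ln 2.
  by apply: le_trans (hn_small _) _; [apply/andP|lra].
have uu : 0 < u ^+ 2 by rewrite exprn_gt0.
have uh : u ^+ 2 <= 2^-1 by nra.
have [||c] := @IVT R hn (u ^+ 2) 2^-1 (t * ln 2) uh.
- apply: continuous_in_subspaceT => y; rewrite inE /= in_itv /= => /andP[y1 y2].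
  by apply: continuous_hn; lra.
- apply/andP; split; first by rewrite ge_min hu.
  by rewrite le_max hn_half; apply/orP; right; nra.
- rewrite in_itv /= => /andP[c1 c2] ec; exists c; split=> //; lra.
Qed.

Lemma HinvP (R : realType) (t : R) : 0 <= t <= 1 ->
  0 <= Hinv t <= 2^-1 /\ hn (Hinv t) = t * ln 2.
Proof.
move=> ht; have [x [hx ex]] := hn_surj ht.
rewrite /Hinv; case: xgetP => [y _ [hy ey]|/(_ x)]; first by rewrite -Hbin_hn ey.
case; split=> //; apply: (mulIf (lt0r_neq0 (ln2_gt0 R))).
by rewrite Hbin_hn.
Qed.

(** * Binomial sums *)

Definition ball_size (m k : nat) : nat := (\sum_(j < k.+1) 'C(m, j))%N.

Definition bterm {R : realType} (p : R) (m k : nat) : R := p ^+ k * (1 - p) ^+ (m - k).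

Lemma sum_bterm (R : realType) (p : R) m :
  \sum_(i < m.+1) 'C(m, i)%:R * bterm p m i = 1.
Proof.
rewrite -[RHS](expr1n _ m) -[in RHS](subrK p 1) exprDn; apply: eq_bigr => i _.
by rewrite /bterm -[RHS]mulr_natl [p ^+ _ * _]mulrC.
Qed.

Lemma bterm_gt0 (R : realType) (p : R) m k : 0 < p < 1 -> 0 < bterm p m k.
Proof. by move=> /andP[p0 p1]; rewrite mulr_gt0 ?exprn_gt0 // subr_gt0. Qed.

Lemma bterm_expR (R : realType) (p : R) m k : 0 < p < 1 -> (k <= m)%N ->
  bterm p m k = expR (- (m%:R * hn p + (k%:R - p * m%:R) * (ln (1 - p) - ln p))).
Proof.
move=> /andP[p0 p1] km; have q0 : 0 < 1 - p by rewrite subr_gt0.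
rewrite /bterm -{1}[p]lnK ?posrE // -{1}[1 - p]lnK ?posrE //.
rewrite -!expRM_natl -expRD; congr expR; rewrite natrB // /hn; ring.
Qed.

(** For j <= k and p <= 1/2 a word of weight j has probability at least [bterm p m k], and
    probabilities sum to 1. The term in k - p * m is kept because k is always a rounded value. *)
Lemma ball_upper (R : realType) (p : R) m k : 0 < p <= 2^-1 -> (k <= m)%N ->
  (ball_size m k)%:R <=
    expR (m%:R * hn p + (k%:R - p * m%:R) * (ln (1 - p) - ln p)).
Proof.
move=> /andP[p0 p2] km; have q0 : 0 < 1 - p by lra.
have b0 := @bterm_gt0 R p m k ltac:(lra).
rewrite -[X in _ <= expR X]opprK expRN -bterm_expR //; last by lra.
rewrite -[leRHS]mul1r ler_pdivlMr //.
rewrite -[leRHS](sum_bterm p m) /ball_size natr_sum mulr_suml.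
rewrite (big_ord_widen m.+1 (fun j => 'C(m, j)%:R * bterm p m k)) //.
rewrite big_mkcond /=; apply: ler_sum => j _; case: ifP => [jk|_].
  rewrite ler_wpM2l //; rewrite ltnS in jk.
  rewrite /bterm -{1}(subnKC jk) exprD -mulrA ler_wpM2l ?(exprn_ge0 _ (ltW p0)) //.
  have -> : (m - j = (k - j) + (m - k))%N by lia.
  rewrite exprD ler_wpM2r ?(exprn_ge0 _ (ltW q0)) //.
  by rewrite lerXn2r ?nnegrE //; lra.
by rewrite mulr_ge0 // ltW // bterm_gt0 //; lra.
Qed.

(** The largest of [m + 1] terms of sum 1 is at least their average; this avoids Stirling's
    formula. *)
Lemma binomial_mode (R : realType) (p : R) m : 0 < p < 1 ->
  exists k, [/\ (k <= m)%N, `|k%:R - p * m%:R| <= 1 &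
    1 <= m.+1%:R * ('C(m, k)%:R * bterm p m k)].
Proof.
move=> /andP[p0 p1]; have q0 : 0 < 1 - p by lra.
pose t k := 'C(m, k)%:R * bterm p m k.
pose k := [arg max_(i > @ord0 m) t i]%O.
have kmax (i : 'I_m.+1) : t i <= t k by rewrite /k; case: arg_maxP => // j _; apply.
exists k; split; first by rewrite -ltnS.
- have crec j : (j < m)%N -> j.+1%:R * 'C(m, j.+1)%:R = (m%:R - j%:R) * 'C(m, j)%:R :> R.
    move=> jm; rewrite -natrB ?(ltnW jm) // -!natrM; congr _%:R.
    by rewrite mul_bin_left.
  have trec j : (j < m)%N -> exists2 b : R, 0 < b &
      t j = 'C(m, j)%:R * (1 - p) * b /\ t j.+1 = 'C(m, j.+1)%:R * p * b.
    move=> jm; exists (p ^+ j * (1 - p) ^+ (m - j.+1)).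
      by rewrite mulr_gt0 ?exprn_gt0.
    rewrite /t /bterm -(subnSK jm) !exprS; split; ring.
  have cpos j : (j <= m)%N -> (0 : R) < 'C(m, j)%:R by rewrite ltr0n bin_gt0.
  (* Comparing the mode with its two neighbours gives (m + 1) * p - 1 <= k <= (m + 1) * p. *)
  have up : k%:R <= (m%:R + 1) * p.
    case: (posnP k) => [->|k0]; first by rewrite mulr_ge0 ?ltW // ltW // ltr_wpDl.
    have jm : (k.-1 < m)%N by rewrite -ltnS prednK.
    have := kmax (Ordinal (ltnW jm : k.-1 < m.+1)%N); rewrite /=.
    have [b b0 [-> e2]] := trec _ jm; rewrite prednK // in e2; rewrite e2 ler_pM2r //.
    have := crec _ jm; have := cpos k.-1 (ltnW jm).
    rewrite prednK // => c0 cr h.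
    have hk : (k : nat)%:R = k.-1%:R + 1 :> R by rewrite natr1 prednK.
    have k0' : (0 : R) < (k : nat)%:R by rewrite ltr0n.
    have h' : (k : nat)%:R * (1 - p) * 'C(m, k.-1)%:R <= p * (m%:R - k.-1%:R) * 'C(m, k.-1)%:R.
      rewrite -[X in _ <= X]mulrA -cr; nra.
    by rewrite ler_pM2r // in h'; nra.
  have lo : (m%:R + 1) * p <= k%:R + 1.
    have : (k <= m)%N by rewrite -ltnS.
    rewrite leq_eqVlt => /orP[/eqP ->|km].
      have : (0 : R) <= m%:R by []. nra.
    have := kmax (Ordinal (km : k.+1 < m.+1)%N); rewrite /=.
    have [b b0 [-> ->]] := trec _ km; rewrite ler_pM2r //.
    have := crec _ km; have := cpos k (ltnW km) => c0 cr h.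
    have k0' : (0 : R) < k.+1%:R by rewrite ltr0n.
    have h' : p * (m%:R - (k : nat)%:R) * 'C(m, k)%:R <= k.+1%:R * (1 - p) * 'C(m, k)%:R.
      rewrite -[X in X <= _]mulrA -cr; nra.
    by rewrite ler_pM2r // -natr1 in h'; nra.
  by rewrite ler_norml; apply/andP; split; lra.
- rewrite -[leLHS](sum_bterm p m) -/(t k).
  apply: (@le_trans _ _ (\sum_(i < m.+1) t k)); first by apply: ler_sum => i _; exact: kmax.
  by rewrite sumr_const card_ord mulr_natl.
Qed.

(** Both estimates hold for the same [k]: in each of the two constructions one of them bounds the
    image and the other the fibres. *)
Lemma ball_estimate (R : realType) (p : R) : 0 <= p <= 2^-1 ->
  exists2 G : R, 0 <= G & forall m, exists k,
  [/\ (k <= m)%N, `|k%:R - p * m%:R| <= 1,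
      expR (m%:R * hn p - G) <= m.+1%:R * 'C(m, k)%:R &
      (ball_size m k)%:R <= expR (m%:R * hn p + G)].
Proof.
move=> /andP[p0 p2].
have [->|pn0] := eqVneq p 0.
  exists 0 => // m; exists 0%N; rewrite hn0 !mulr0 subrr mul0r subrr normr0 addr0 expR0.
  by rewrite /ball_size big_ord1 bin0 mulr1 ler1n.
have {p0} p0 : 0 < p by rewrite lt0r pn0.
have g0 : 0 <= ln (1 - p) - ln p by rewrite subr_ge0 ler_ln ?posrE; lra.
exists (ln (1 - p) - ln p) => // m.
have [|k [km kp h]] := @binomial_mode R p m; first lra.
exists k; split=> //; move: (kp); rewrite ler_norml => /andP[kp1 kp2].
  have b0 := @bterm_gt0 R p m k ltac:(lra).
  rewrite mulrA -ler_pdivrMr // mul1r bterm_expR // -?expRN ?opprK in h; last by lra.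
  by apply: le_trans h; rewrite ler_expR; nra.
have pp : 0 < p <= 2^-1 by rewrite p0.
apply: le_trans (ball_upper pp km) _.
by rewrite ler_expR; nra.
Qed.

(** * Hamming distance, covering codes and balanced subsets *)

Local Open Scope nat_scope.

Definition weight (s : seq bool) : nat := count id s.
Definition bxor (s t : seq bool) : seq bool := [seq p.1 (+) p.2 | p <- zip s t].
Definition hamming (s t : seq bool) : nat := weight (bxor s t).

Lemma bxor_cons a s b t : bxor (a :: s) (b :: t) = a (+) b :: bxor s t.
Proof. by []. Qed.

Lemma size_bxor s t : size s = size t -> size (bxor s t) = size s.
Proof. by move=> e; rewrite size_map size_zip e minnn. Qed.

Lemma bxorK s t : size s = size t -> bxor s (bxor s t) = t.
Proof.
elim: s t => [|a s IH] [|b t] // [e]; rewrite !bxor_cons IH // addbA.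
by case: a.
Qed.

Lemma hamming_cat s t s' t' : size s = size t -> hamming (s ++ s') (t ++ t') = hamming s t + hamming s' t'.
Proof. by move=> e; rewrite /hamming /bxor zip_cat // map_cat /weight count_cat. Qed.

Lemma hammingxx s : hamming s s = 0.
Proof. by rewrite /hamming /weight; elim: s => //= a s; rewrite addbb. Qed.

Lemma hamming_le s t : hamming s t <= size s.
Proof.
rewrite /hamming /weight; apply: leq_trans (count_size _ _) _.
by rewrite size_map size_zip geq_minl.
Qed.

Lemma weight_le_hamming s t : size s = size t -> weight t <= weight s + hamming s t.
Proof.
rewrite /hamming /weight; elim: s t => [|a s IH] [|b t] // [/IH]; rewrite bxor_cons /=.
by case: a b => [] [] /=; lia.
Qed.

Lemma weight_le s : weight s <= size s.
Proof. exact: count_size. Qed.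

Definition negs (s : seq bool) : seq bool := map negb s.

Lemma weight_negs s : weight (negs s) = size s - weight s.
Proof.
rewrite /weight /negs count_map -(count_predC id s) addKn.
by apply: eq_count.
Qed.

Lemma negsK s : negs (negs s) = s.
Proof. by rewrite /negs -map_comp -[RHS]map_id; apply: eq_map => b /=; exact: negbK. Qed.

(** * Strings as sets of positions *)

Definition toset m (s : seq bool) : {set 'I_m} := [set i : 'I_m | nth false s i].
Definition toseq m (A : {set 'I_m}) : seq bool := [seq i \in A | i <- enum 'I_m].

Lemma size_toseq m (A : {set 'I_m}) : size (toseq A) = m.
Proof. by rewrite size_map size_enum_ord. Qed.

Lemma nth_toseq m (A : {set 'I_m}) (i : 'I_m) : nth false (toseq A) i = (i \in A).
Proof.
rewrite (nth_map i) ?size_enum_ord //.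
by rewrite (_ : nth i _ i = i) //; apply: val_inj; rewrite /= nth_enum_ord.
Qed.

Lemma tosetK m s : size s = m -> toseq (toset m s) = s.
Proof.
move=> e; apply: (@eq_from_nth _ false); rewrite size_toseq ?e // => i lt.
by rewrite (nth_toseq _ (Ordinal lt)) inE.
Qed.

Lemma toseqK m (A : {set 'I_m}) : toset m (toseq A) = A.
Proof. by apply/setP => i; rewrite inE nth_toseq. Qed.

Lemma weight_toseq m (A : {set 'I_m}) : weight (toseq A) = #|A|.
Proof.
rewrite /weight count_map -sum1_count -sum1_card.
by rewrite big_enum_cond.
Qed.

Lemma bxor_toseq m (A B : {set 'I_m}) :
  bxor (toseq A) (toseq B) = toseq [set i | (i \in A) (+) (i \in B)].
Proof.
rewrite /bxor /toseq; elim: (enum 'I_m) => //= i l IH.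
by rewrite IH inE.
Qed.

Lemma hamming_toseq_sub m (A B : {set 'I_m}) : A \subset B ->
  hamming (toseq A) (toseq B) = #|B| - #|A|.
Proof.
move=> AB; rewrite /hamming bxor_toseq weight_toseq -cardsDS //.
apply: eq_card => i; rewrite !inE.
by have /fintype.subsetP/(_ i) := AB; case: (i \in A) => [->|] //; case: (i \in B).
Qed.

Lemma card_small_sets m k : #|[set A : {set 'I_m} | #|A| <= k]| = ball_size m k.
Proof.
rewrite -sum1dep_card (partition_big (fun A : {set 'I_m} => inord #|A| : 'I_k.+1) xpredT) //=.
rewrite /ball_size; apply: eq_bigr => j _.
rewrite -[in RHS](card_ord m) -card_draws -sum1dep_card; apply: eq_bigl => A.
case: leqP => [Ak|kA] /=; first by rewrite -val_eqE /= inordK.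
by apply/esym/eqP => e; have := ltn_ord j; rewrite ltnS -e leqNgt kA.
Qed.

Definition low m k : seq (seq bool) :=
  [seq toseq A | A <- enum [set A : {set 'I_m} | #|A| <= k]].

Lemma size_low m k : size (low m k) = ball_size m k.
Proof. by rewrite size_map -cardE card_small_sets. Qed.

Lemma mem_low m k s : size s = m -> weight s <= k -> s \in low m k.
Proof.
move=> sm sk; apply/mapP; exists (toset m s); last by rewrite tosetK.
by rewrite mem_enum inE -weight_toseq tosetK.
Qed.

Lemma ball_size_le m k : ball_size m k <= 2 ^ m.
Proof.
by rewrite -card_small_sets -[m in 2 ^ m]card_ord -cardsT -card_powerset powersetT subset_leq_card ?finset.subsetT.
Qed.

Lemma card_setI m : #|{: {set 'I_m}}| = 2 ^ m.
Proof. by rewrite -cardsT -powersetT card_powerset cardsT card_ord. Qed.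

Lemma bin_le_ball m k : 'C(m, k) <= ball_size m k.
Proof. by rewrite /ball_size (bigD1 ord_max) //= leq_addr. Qed.

Lemma card_ball m k (B : {set 'I_m}) :
  #|[set A : {set 'I_m} | hamming (toseq A) (toseq B) <= k]| = ball_size m k.
Proof.
rewrite -card_small_sets.
pose f (A : {set 'I_m}) := [set i | (i \in A) (+) (i \in B)].
have injf : injective f.
  apply: (can_inj (g := f)) => A; apply/setP => i; rewrite !inE.
  by rewrite -addbA addbb addbF.
rewrite -[RHS](card_preimset _ injf); apply: eq_card => A.
by rewrite !inE /hamming bxor_toseq weight_toseq.
Qed.

Lemma covering_code (R : realType) m k : (k <= m) ->
  exists C : {set {set 'I_m}},
    (forall B : {set 'I_m}, exists2 A, A \in C & hamming (toseq A) (toseq B) <= k) /\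
    #|C| * ball_size m k <= m.+1 * 2 ^ m.
Proof.
move=> km; set V := ball_size m k; set N := 2 ^ m.
have N0 : 0 < N by rewrite expn_gt0.
have V0 : 0 < V by apply: leq_trans (bin_le_ball m k); rewrite bin_gt0.
have VN : V <= N by exact: ball_size_le.
(* Now t * V > m * N, so fewer than N * exp (- m) <= 1 words remain uncovered, that is, none. *)
pose t := (m * N %/ V).+1.
have [||C [lC hC]] := @greedy_cover {set 'I_m} (fun A B => hamming (toseq A) (toseq B) <= k) V t.
- by rewrite card_setI.
- by move=> B; rewrite card_ball.
rewrite card_setI -/N in hC; exists C; split; last first.
  apply: (@leq_trans (t * V)); first by rewrite leq_mul2r lC orbT.
  by rewrite /t mulSn mulSn leq_add // leq_divM.
move=> B; apply/exists_inP; apply: contraT => hB.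
have W0 : 0 < #|[set y : {set 'I_m} | [forall A in C, ~~ (hamming (toseq A) (toseq y) <= k)]]|.
  by apply/fintype.card_gt0P; exists B; rewrite inE -negb_exists_in.
suff : N * (N - V) ^ t < N ^ t.
  by rewrite ltnNge (leq_trans _ hC) // leq_pmull.
have hR : (N%:R * (N - V)%N%:R ^+ t < N%:R ^+ t :> R)%R.
  have NR : (0 < N%:R :> R)%R by rewrite ltr0n.
  rewrite natrB //.
  have -> : (N%:R - V%:R = N%:R * (1 - V%:R / N%:R) :> R)%R.
    by rewrite mulrBr mulr1 mulrCA divff ?mulr1 // gt_eqF.
  rewrite exprMn mulrCA gtr_pMr ?exprn_gt0 //.
  have q1 : (0 <= 1 - V%:R / N%:R :> R)%R.
    by rewrite subr_ge0 ler_pdivrMr // mul1r ler_nat.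
  have q2 : (1 - V%:R / N%:R <= expR (- (V%:R / N%:R)) :> R)%R.
    exact: expR_ge1Dx.
  have q3 : ((1 - V%:R / N%:R) ^+ t <= expR (- (V%:R / N%:R)) ^+ t :> R)%R.
    by rewrite lerXn2r ?nnegrE ?expR_ge0.
  apply: le_lt_trans (ler_wpM2l (ltW NR) q3) _.
  rewrite -expRM_natl.
  have q4 : (t%:R * - (V%:R / N%:R) < - m%:R :> R)%R.
    rewrite mulrN ltrN2 mulrA ltr_pdivlMr // -!natrM ltr_nat.
    by rewrite /t ltn_ceil.
  apply: (@lt_le_trans _ _ (N%:R * expR (- m%:R))%R); first by rewrite ltr_pM2l // ltr_expR.
  rewrite expRN ler_pdivrMr ?expR_gt0 // mul1r /N natrX.
  rewrite -[(m%:R)%R in leRHS]mulr1 expRM_natl lerXn2r ?nnegrE ?expR_ge0 //.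
  by apply: ltW; have := @expR_gt1Dx R 1%R; apply; exact: oner_neq0.
by rewrite -(ltr_nat R) natrM (natrX R (N - V)) (natrX R N).
Qed.

(** Inclusion between sets of sizes [k] and [w] is biregular, as [balanced_assignment] wants; the
    resulting bound is uniform in [w]. *)
Lemma balanced_subsets m k w : k <= w <= m ->
  exists f : {set 'I_m} -> {set 'I_m},
    (forall B : {set 'I_m}, #|B| = w -> f B \subset B /\ #|f B| = k) /\
    forall A, #|[set B : {set 'I_m} | (#|B| == w) && (f B == A)]| <=
      2 * (2 ^ m %/ 'C(m, k)).+1 + m.+1.
Proof.
move=> /andP[kw wm].
pose e (A B : {set 'I_m}) := (A \subset B) && (#|A| == k).
have C0 : 0 < 'C(m, k) by rewrite bin_gt0 (leq_trans kw).
have deg (A : {set 'I_m}) : #|A| = k ->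
    #|[set B : {set 'I_m} | (#|B| == w) && (A \subset B)]| = 'C(m - k, m - w).
  move=> Ak; have -> : 'C(m - k, m - w) =
      #|[set D : {set 'I_m} | D \subset finset.setC A & #|D| == m - w]|.
    by rewrite cards_draws cardsCs finset.setCK card_ord Ak.
  rewrite -[RHS](card_preimset _ (@finset.setC_inj 'I_m)); apply: eq_card => B.
  rewrite !inE finset.setCS andbC; congr (_ && _).
  rewrite [#|finset.setC B|]cardsCs finset.setCK card_ord.
  have Bm : #|B| <= m by rewrite -[X in _ <= X]card_ord max_card.
  by apply/eqP/eqP; lia.
have [] := @balanced_assignment _ _ [set B : {set 'I_m} | #|B| == w] e
  'C(m - k, m - w) 'C(w, k) (2 ^ m %/ 'C(m, k)).+1 m.+1.
- by [].
- by rewrite bin_gt0.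
(* The degrees have ratio 'C(m, w) / 'C(m, k), which is at most 2^m / 'C(m, k). *)
- have dc : 'C(m, k) * 'C(m - k, m - w) = 'C(m, w) * 'C(w, k).
    have := double_count (fun A B : {set 'I_m} => [&& #|A| == k, #|B| == w & A \subset B]).
    rewrite (bigID (fun A : {set 'I_m} => #|A| == k)) /= [X in _ + X]big1 ?addn0; last first.
      by move=> A /negbTE Ak; apply/eqP; rewrite cards_eq0; apply/eqP/setP => B; rewrite !inE Ak.
    rewrite (eq_bigr (fun=> 'C(m - k, m - w))); last first.
      by move=> A /eqP Ak; rewrite -(deg A Ak); apply: eq_card => B; rewrite !inE Ak eqxx.
    rewrite [RHS](bigID (fun B : {set 'I_m} => #|B| == w)) /= [X in _ = _ + X -> _]big1 ?addn0; last first.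
      by move=> B /negbTE Bw; apply/eqP; rewrite cards_eq0; apply/eqP/setP => A; rewrite !inE Bw andbF.
    rewrite [RHS](eq_bigr (fun=> 'C(w, k))); last first.
      move=> B /eqP Bw; rewrite -Bw -cards_draws; apply: eq_card => A.
      by rewrite !inE Bw eqxx andbC.
    have cd j : #|[pred A : {set 'I_m} | #|A| == j]| = 'C(m, j).
      by rewrite -[in RHS](card_ord m) -card_draws; apply: eq_card => A; rewrite !inE.
    by rewrite !sum_nat_const !cd.
  rewrite -(leq_pmul2l C0) dc.
  apply: (@leq_trans (2 ^ m * 'C(w, k))).
    by rewrite leq_mul2r (leq_trans (bin_le_ball m w)) ?orbT // ball_size_le.
  rewrite mulnA leq_mul2r; apply/orP; right.
  by rewrite mulnC; exact/ltnW/ltn_ceil.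
- by rewrite card_setI ltn_exp2l.
- move=> B; rewrite inE => /eqP Bw; rewrite /e cards_draws Bw //.
- move=> A; case: (eqVneq #|A| k) => Ak.
    rewrite -(deg A Ak); apply: eq_leq; apply: eq_card => B.
    by rewrite !inE /e Ak eqxx andbT.
  rewrite (_ : [set _ in _ | _] = finset.set0) ?cards0 //.
  by apply/setP => B; rewrite !inE /e (negbTE Ak) !andbF.
- by exists finset.set0.
move=> f [h1 h2]; exists f; split.
  by move=> B Bw; have /andP[? /eqP ?] := h1 B ltac:(by rewrite inE Bw).
move=> A; apply: ltnW; apply: leq_ltn_trans (h2 A); apply: eq_leq.
by apply: eq_card => B; rewrite !inE.
Qed.

(** * Block codes *)

Local Open Scope ring_scope.

(* [2 ^ (t * m)] up to a factor polynomial in [m]. *)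
Definition pexp {R : realType} (K : R) (d : nat) (t : R) (m : nat) : R :=
  expR (t * ln 2 * m%:R + K) * m.+1%:R ^+ d.

Lemma ln2_lt1 (R : realType) : ln (2 : R) < 1.
Proof. by have := @ln_ltB1 R 2; rewrite ltr0n pnatr_eq1 => /(_ isT isT); lra. Qed.

Lemma expR_mln2 (R : realType) (m : nat) : expR (m%:R * ln 2 : R) = 2 ^+ m.
Proof. by rewrite expRM_natl lnK // posrE. Qed.

Lemma pexp_ge (R : realType) (K t : R) d m x : (0 <= K) -> (x <= t * ln 2 * m%:R + K) ->
  expR x <= pexp K d t m.
Proof.
move=> K0 h; rewrite -[leLHS]mulr1 ler_pM ?expR_ge0 // ?ler_expR //.
by rewrite exprn_ege1 // ler1n.
Qed.

(* [L1] lists the image of [F], [L2 x] the fibre over [x], and [S] the exceptional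
   strings at tolerance [e]; that [delta] is independent of [m] is essential, since
   nothing is known about how fast a sequence of dimension 1 approaches it. *)
Definition code_part {R : realType} (s rho : R) : Prop :=
  exists (K : R) (d : nat) (delta : R -> R),
  [/\ 0 <= K, (forall e, 0 < e -> 0 < delta e <= 1) &
  forall m : nat, exists (F : seq bool -> seq bool) (L1 : seq (seq bool))
    (L2 : seq bool -> seq (seq bool)),
  [/\ forall y, size y = m -> [/\ size (F y) = m, F y \in L1 & y \in L2 (F y)],
      (size L1)%:R <= pexp K d s m,
      forall x, (size (L2 x))%:R <= pexp K d (1 - s) m &
      forall e, 0 < e -> exists S : seq (seq bool),
        [/\ (size S)%:R <= pexp K d (1 - delta e) m,
            forall y, size y = m -> y \notin S ->
              (hamming (F y) y)%:R <= (rho + e) * m%:R + K &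
            forall y z, size y = m -> size z = m -> z \notin S ->
              (rho - e) * m%:R - K <= (hamming (F y) z)%:R ]]].

(** The words within (a - e) * m of the image are exceptional. Their number has exponent s + H(a -
    e), which is below 1 because s = 1 - H(a) and H increases on [0, 1/2]. *)
Lemma code_part_covering (R : realType) (s a : R) : 0 <= a <= 2^-1 ->
  hn a = (1 - s) * ln 2 -> code_part s a.
Proof.
move=> ha ea; have [G G0 hG] := ball_estimate ha.
have l2 := ln2_gt0 R.
(* For e >= a the lower bound on distances is void and the exceptional set is empty. *)
pose delta e : R := if a - e <= 0 then 1 else
  Num.min 1 ((hn a - hn (a - e)) / ln 2).
exists (G + 1), 2%N, delta; split; first by lra.
  move=> e e0; rewrite /delta; case: (leP (a - e) 0) => [_|ae]; first by rewrite ltr01 lexx.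
  rewrite /= ge_min lexx lt_min ltr01 /= andbT divr_gt0 // subr_gt0.
  by apply: hn_lt => //; lra.
move=> m; have [k [km ka hC hB]] := hG m.
have [C [cov sC]] := covering_code R km.
have sCR : (#|C|)%:R <= pexp (G + 1) 2%N s m.
  have b0 : (0 : R) < 'C(m, k)%:R by rewrite ltr0n bin_gt0.
  have h1 : #|C|%:R * 'C(m, k)%:R <= m.+1%:R * 2 ^+ m :> R.
    rewrite -natrX -!natrM ler_nat (leq_trans _ sC) // leq_mul2l bin_le_ball orbT //.
  have h2 : #|C|%:R * expR (m%:R * hn a - G) <= m.+1%:R ^+ 2 * expR (m%:R * ln 2).
    rewrite expR_mln2; apply: (le_trans (ler_wpM2l _ hC)) => //.
    by rewrite mulrCA expr2 -mulrA ler_wpM2l.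
  rewrite -ler_pdivlMr ?expR_gt0 // -mulrA -expRN -expRD in h2.
  apply: (le_trans h2); rewrite /pexp mulrC ler_wpM2r ?exprn_ge0 // ler_expR ea; lra.
pose F y := toseq (odflt finset.set0
  [pick A in C | (hamming (toseq A) (toseq (toset m y)) <= k)%N]).
(* The fibre over [x] is listed as the whole ball around [x], whose exponent H(a) equals 1 - s. *)
exists F, [seq toseq A | A <- enum C], (fun x => [seq bxor x z | z <- low m k]).
have FP y : size y = m -> exists A, [/\ A \in C, F y = toseq A & (hamming (F y) y <= k)%N].
  move=> sy; rewrite /F; case: pickP => /= [A /andP[AC h]|h].
    by exists A; split=> //; rewrite tosetK in h.
  have [A AC hA] := cov (toset m y).
  by have := h A; rewrite /= AC hA.
split.
- move=> y sy; have [A [AC eF hk]] := FP y sy; split.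
  + by rewrite eF size_toseq.
  + by rewrite eF; apply: map_f; rewrite mem_enum.
  + apply/mapP; exists (bxor (F y) y); last by rewrite bxorK // eF size_toseq.
    by rewrite mem_low // size_bxor eF ?size_toseq.
- by rewrite size_map -cardE.
- move=> x; rewrite size_map size_low; apply: (le_trans hB).
  by apply: pexp_ge; rewrite ?ea; lra.
- move=> e e0.
  have near (S : seq (seq bool)) y : size y = m -> y \notin S -> (hamming (F y) y)%:R <= (a + e) * m%:R + (G + 1).
    move=> sy _; have [A [_ _ hk]] := FP y sy.
    have : (hamming (F y) y)%:R <= k%:R :> R by rewrite ler_nat.
    move: ka; rewrite ler_norml => /andP[_ ?].
    have : 0 <= e * m%:R by rewrite mulr_ge0 // ltW. lra.
  case: (leP (a - e) 0) => [ae|ae].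
    exists [::]; split; [|exact: near|move=> y z sy sz _].
      by rewrite mulr_ge0 ?expR_ge0 // exprn_ge0.
    have : 0 <= (hamming (F y) z)%:R :> R by [].
    have : (a - e) * m%:R <= 0 by rewrite mulr_le0_ge0. lra.
  pose j := Num.truncn ((a - e) * m%:R).
  have jr : 0 <= (a - e) * m%:R by rewrite mulr_ge0 // ltW.
  have [j1 j2] : j%:R <= (a - e) * m%:R /\ (a - e) * m%:R < j.+1%:R.
    by have := truncn_itv jr => /andP[].
  have jm : (j <= m)%N.
    rewrite -(ler_nat R); apply: (le_trans j1); rewrite -[leRHS]mul1r ler_wpM2r //; lra.
  exists [seq bxor c z | c <- [seq toseq A | A <- enum C], z <- low m j]; split.
  + rewrite size_allpairs size_map -cardE size_low natrM.
    have hb := @ball_upper R (a - e) m j ltac:(lra) jm.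
    apply: le_trans (ler_pM _ _ sCR hb) _ => //.
    rewrite /pexp mulrAC -expRD ler_wpM2r ?exprn_ge0 // ler_expR /delta (leNgt (a - e) 0) ae /=.
    have g0 : 0 <= ln (1 - (a - e)) - ln (a - e) by rewrite subr_ge0 ler_ln ?posrE; lra.
    have h1 : (j%:R - (a - e) * m%:R) * (ln (1 - (a - e)) - ln (a - e)) <= 0.
      by rewrite mulr_le0_ge0 //; lra.
    set D := Num.min _ _.
    have hD : D * ln 2 <= hn a - hn (a - e).
      by rewrite -ler_pdivlMr // ge_min lexx orbT.
    have : D * ln 2 * m%:R <= (hn a - hn (a - e)) * m%:R by rewrite ler_wpM2r.
    rewrite ea; lra.
  + exact: near.
  + move=> y z sy sz hz; have [A [AC eF hk]] := FP y sy.
    have : (j < hamming (F y) z)%N.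
      rewrite ltnNge; apply/negP => h; move/negP: hz; apply.
      apply/allpairsP; exists (F y, bxor (F y) z); split => /=.
      * by rewrite eF; apply: map_f; rewrite mem_enum.
      * by rewrite mem_low // size_bxor eF ?size_toseq.
      * by rewrite bxorK // eF size_toseq.
    rewrite -(ler_nat R) => h; have := ltW j2; lra.
Qed.

Lemma size_flatten_le (T : Type) (ss : seq (seq T)) b :
  all (fun s => size s <= b)%N ss -> (size (flatten ss) <= size ss * b)%N.
Proof.
elim: ss => //= s ss IH /andP[h1 /IH h2]; rewrite size_cat mulSn; exact: leq_add.
Qed.

(** Images have weight at most about p * m and typical words weight about m/2, which bounds their
    distance from below; a subset of a typical word attains the bound. Exceptional are the words of
    atypical weight. *)
Lemma code_part_subsets (R : realType) (s p : R) : 0 <= p <= 2^-1 ->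
  hn p = s * ln 2 -> code_part s (2^-1 - p).
Proof.
move=> hp ep; have [G G0 hG] := ball_estimate hp.
have l2 := ln2_gt0 R.
pose delta e : R := if 2^-1 - e <= 0 then 1 else
  Num.min 1 ((ln 2 - hn (2^-1 - e)) / ln 2).
(* A list [L2 x] has at most 6 * Q * (m + 1)^2 words, where Q = 2^m / 'C(m, k) brings one more
   factor m + 1; the 5 comes from 6 <= exp 5. *)
exists (G + 5), 3%N, delta; split; first by lra.
  move=> e e0; rewrite /delta; case: (leP (2^-1 - e) 0) => [_|ae]; first by rewrite ltr01 lexx.
  rewrite ge_min lexx lt_min ltr01 /= andbT divr_gt0 // subr_gt0 -hn_half.
  by apply: hn_lt => //; lra.
move=> m; have [k [km ka hC hB]] := hG m.
have /choice[f hf] : forall w, exists f : {set 'I_m} -> {set 'I_m}, (k <= w <= m)%N ->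
    (forall B : {set 'I_m}, #|B| = w -> f B \subset B /\ #|f B| = k) /\
    forall A, (#|[set B : {set 'I_m} | (#|B| == w) && (f B == A)]| <=
      2 * (2 ^ m %/ 'C(m, k)).+1 + m.+1)%N.
  move=> w; have [hw|_] := boolP (k <= w <= m)%N; last by exists id.
  by have [f ?] := balanced_subsets hw; exists f.
pose F y := if (weight y <= k)%N then y else toseq (f (weight y) (toset m y)).
(* The entry [x] accounts for the words of weight at most [k], which [F] fixes; each larger weight
   has its own balanced map. *)
pose L2 x := x :: flatten [seq [seq toseq B |
   B <- enum [set B : {set 'I_m} | (#|B| == w) && (f w B == toset m x)]] | w <- iota k (m.+1 - k)].
have FP y : size y = m -> [/\ size (F y) = m, (weight (F y) <= k)%N &
    hamming (F y) y = (weight y - k)%N].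
  move=> sy; rewrite /F; case: leqP => h.
    by split=> //; rewrite hammingxx; apply/esym/eqP; rewrite subn_eq0.
  have hw : (k <= weight y <= m)%N by rewrite (ltnW h) -sy weight_le.
  have [h1 _] := hf _ hw; have [] := h1 (toset m y); first by rewrite -weight_toseq tosetK.
  move=> sub ck; rewrite size_toseq weight_toseq ck; split=> //.
  by rewrite -[y in hamming _ y](tosetK sy) hamming_toseq_sub // -weight_toseq tosetK // ck.
exists F, (low m k), L2; split.
- move=> y sy; have [sF wF _] := FP y sy; split=> //; first exact: mem_low.
  rewrite /L2 inE; have [h|h] := boolP (weight y <= k)%N.
    by rewrite {1}/F h eqxx.
  apply/orP; right; apply/flattenP.
  exists [seq toseq B | B <- enum [set B : {set 'I_m} |
     (#|B| == weight y) && (f (weight y) B == toset m (F y))]].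
    apply/mapP; exists (weight y) => //; rewrite mem_iota.
    by have := weight_le y; rewrite -ltnNge in h; lia.
  apply/mapP; exists (toset m y); last by rewrite tosetK.
  rewrite mem_enum inE -weight_toseq tosetK // eqxx /=.
  by rewrite /F (negbTE h) toseqK.
- rewrite size_low; apply: (le_trans hB); apply: pexp_ge; rewrite ?ep; lra.
- move=> x; pose q := (2 ^ m %/ 'C(m, k))%N.
  have C0 : (0 < 'C(m, k))%N by rewrite bin_gt0.
  have CR : (0 : R) < 'C(m, k)%:R by rewrite ltr0n.
  have s1 : (size (L2 x) <= 1 + m.+1 * (2 * q.+1 + m.+1))%N.
    rewrite /L2 /= ltnS; apply: leq_trans (size_flatten_le (b := 2 * q.+1 + m.+1) _) _.
      apply/allP => t /mapP[w]; rewrite mem_iota => hw ->.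
      rewrite size_map -cardE.
      have hw' : (k <= w <= m)%N by lia.
      by have [_] := hf w hw'; apply.
    by rewrite size_map size_iota leq_mul2r leq_subr orbT.
  pose Q : R := 2 ^+ m / 'C(m, k)%:R.
  have qQ : q%:R <= Q.
    by rewrite /Q ler_pdivlMr // -natrX -natrM ler_nat leq_divM.
  have Q1 : 1 <= Q.
    by rewrite /Q ler_pdivlMr // mul1r -natrX ler_nat (leq_trans (bin_le_ball m k)) ?ball_size_le.
  have QE : Q <= m.+1%:R * expR ((1 - s) * ln 2 * m%:R + G).
    rewrite /Q ler_pdivrMr // mulrAC.
    have := ler_wpM2r (expR_ge0 ((1 - s) * ln 2 * m%:R + G)) hC.
    apply: le_trans.
    rewrite -expRD -expR_mln2 ler_expR ep; lra.
  have n1 : 1 <= m.+1%:R :> R by rewrite ler1n.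
  have s2 : (size (L2 x))%:R <= 6 * Q * m.+1%:R ^+ 2.
    have : (size (L2 x))%:R <= (1 + m.+1 * (2 * q.+1 + m.+1))%N%:R :> R by rewrite ler_nat.
    rewrite natrD natrM natrD natrM -[q.+1%:R]natr1.
    move: qQ Q1 n1; move: (q%:R : R) (m.+1%:R : R) => u n; move=> uQ Q1 n1 hs.
    have a1 : n <= n ^+ 2 by nra.
    have a2 : n ^+ 2 <= Q * n ^+ 2 by nra.
    have a3 : n * u <= n * Q by nra.
    have a4 : n * Q <= Q * n ^+ 2 by nra.
    lra.
  apply: (le_trans s2).
  have e6 : 6 <= expR (5 : R) by have := expR_ge1Dx (5 : R); lra.
  rewrite /pexp addrA expRD.
  set E := expR (_ + G) in QE *.
  have E0 : 0 < E by exact: expR_gt0.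
  have n20 : 0 <= m.+1%:R ^+ 2 :> R by rewrite exprn_ge0.
  rewrite [_ ^+ 3]exprS mulrA ler_wpM2r //.
  apply: (@le_trans _ _ (6 * (m.+1%:R * E))); first by rewrite ler_pM2l.
  by rewrite mulrCA mulrC ler_wpM2r // mulrC ler_wpM2l // ltW.
- move=> e e0.
  suff [S [sS hS]] : exists S : seq (seq bool), (size S)%:R <= pexp (G + 5) 3%N (1 - delta e) m /\
      forall y, size y = m -> y \notin S -> (2^-1 - e) * m%:R <= (weight y)%:R <= (2^-1 + e) * m%:R.
    exists S; split=> //.
      move=> y sy yS; have [_ _ ->] := FP y sy.
      have /andP[_ h] := hS y sy yS.
      move: ka; rewrite ler_norml => /andP[ka1 ka2].
      case: (leqP (weight y) k) => hk.
        rewrite (eqP hk); have : 0 <= (2^-1 - p + e) * m%:R by rewrite mulr_ge0 //; lra.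
        lra.
      rewrite natrB ?(ltnW hk) //; lra.
    move=> y z sy sz zS; have [sF wF _] := FP y sy.
    have /andP[h _] := hS z sz zS.
    move: ka; rewrite ler_norml => /andP[ka1 ka2].
    have : (weight z <= weight (F y) + hamming (F y) z)%N by rewrite weight_le_hamming // sF sz.
    have : (weight (F y))%:R <= k%:R :> R by rewrite ler_nat.
    rewrite -(ler_nat R) natrD; lra.
  case: (leP (2^-1 - e) 0) => [ae|ae].
    exists [::]; split; first by rewrite mulr_ge0 ?expR_ge0 // exprn_ge0.
    move=> y sy _; have : (weight y)%:R <= m%:R :> R by rewrite ler_nat -sy weight_le.
    have : 0 <= (weight y)%:R :> R by [].
    have : 0 <= m%:R :> R by [].
    by move=> *; apply/andP; split; nra.
  pose j := Num.truncn ((2^-1 - e) * m%:R).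
  have jr : 0 <= (2^-1 - e) * m%:R by rewrite mulr_ge0 // ltW.
  have [j1 j2] : j%:R <= (2^-1 - e) * m%:R /\ (2^-1 - e) * m%:R < j.+1%:R.
    by have := truncn_itv jr => /andP[].
  have jm : (j <= m)%N.
    rewrite -(ler_nat R); apply: (le_trans j1); rewrite -[leRHS]mul1r ler_wpM2r //; lra.
  exists (low m j ++ [seq negs z | z <- low m j]); split.
    rewrite size_cat size_map !size_low addnn -mul2n natrM.
    have hb := @ball_upper R (2^-1 - e) m j ltac:(lra) jm.
    apply: le_trans (ler_wpM2l _ hb) _ => //.
    have e2 : 2 <= expR (1 : R) by have := expR_ge1Dx (1 : R); lra.
    apply: le_trans (ler_wpM2r (expR_ge0 _) e2) _.
    rewrite -expRD; apply: pexp_ge; first lra.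
    have g0 : 0 <= ln (1 - (2^-1 - e)) - ln (2^-1 - e) by rewrite subr_ge0 ler_ln ?posrE; lra.
    have h1 : (j%:R - (2^-1 - e) * m%:R) * (ln (1 - (2^-1 - e)) - ln (2^-1 - e)) <= 0.
      by rewrite mulr_le0_ge0 //; lra.
    rewrite /delta (leNgt (2^-1 - e) 0) ae /=; set D := Num.min _ _.
    have hD : D * ln 2 <= ln 2 - hn (2^-1 - e).
      by rewrite -ler_pdivlMr // ge_min lexx orbT.
    have : D * ln 2 * m%:R <= (ln 2 - hn (2^-1 - e)) * m%:R by rewrite ler_wpM2r.
    lra.
  move=> y sy; rewrite mem_cat negb_or => /andP[n1 n2].
  have w1 : (j < weight y)%N.
    by rewrite ltnNge; apply: contra n1 => h; exact: mem_low.
  have w2 : (j < m - weight y)%N.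
    rewrite ltnNge; apply: contra n2 => h; apply/mapP; exists (negs y); rewrite ?negsK //.
    by apply: mem_low; rewrite ?size_map // weight_negs sy.
  have wm : (weight y <= m)%N by rewrite -sy weight_le.
  have w1' : j.+1%:R <= (weight y)%:R :> R by rewrite ler_nat.
  have w2' : j.+1%:R <= m%:R - (weight y)%:R :> R by rewrite -natrB // ler_nat.
  apply/andP; split; lra.
Qed.

Lemma mem_all_strings m s : size s = m -> s \in low m m.
Proof. by move=> sm; apply: mem_low => //; rewrite -sm weight_le. Qed.

Lemma pexp_one_ge (R : realType) m : (size (low m m))%:R <= pexp 0 0 (1 : R) m.
Proof.
rewrite size_low; apply: (@le_trans _ _ (2 ^ m)%:R).
  by rewrite ler_nat ball_size_le.
by rewrite natrX -expR_mln2; apply: pexp_ge => //; lra.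
Qed.

Lemma pexp_prod_le (R : realType) (K1 K2 t1 t2 K t : R) d1 d2 m1 m2 :
  t1 * ln 2 * m1%:R + K1 + (t2 * ln 2 * m2%:R + K2) <= t * ln 2 * (m1 + m2)%:R + K ->
  pexp K1 d1 t1 m1 * pexp K2 d2 t2 m2 <= pexp K (d1 + d2) t (m1 + m2).
Proof.
move=> h; rewrite /pexp mulrACA -expRD exprD ler_pM ?expR_ge0 ?ler_expR //.
by rewrite ler_pM ?exprn_ge0 // lerXn2r ?nnegrE // ler_nat ltnS ?leq_addr ?leq_addl.
Qed.

Lemma pexp_mono (R : realType) (K K' t : R) d d' m : K <= K' -> (d <= d')%N ->
  pexp K d t m <= pexp K' d' t m.
Proof.
move=> hK hamming; rewrite ler_pM ?expR_ge0 ?exprn_ge0 // ?ler_expR; first lra.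
by rewrite ler_weXn2l // ler1n.
Qed.

(** Since both parts have the same [s], the sizes of images and fibres multiply to the right
    exponents. The bounds on [r1] and [r2] control the effect of rounding alpha * m. *)
Lemma code_part_convex (R : realType) (s r1 r2 alpha : R) :
  0 <= r1 <= 2^-1 -> 0 <= r2 <= 2^-1 -> 0 <= alpha <= 1 ->
  code_part s r1 -> code_part s r2 ->
  code_part s (alpha * r1 + (1 - alpha) * r2).
Proof.
move=> hr1 hr2 /andP[a0 a1] p1 p2.
have [e0|an0] := eqVneq alpha 0; first by rewrite e0 mul0r add0r subr0 mul1r.
have [e1|an1] := eqVneq alpha 1; first by rewrite e1 subrr mul0r addr0 mul1r.
have {an0} a0 : 0 < alpha by rewrite lt0r an0.
have {an1} a1 : alpha < 1 by rewrite lt_neqAle an1.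
have [K1 [d1 [delta1 [K10 hd1 h1]]]] := p1.
have [K2 [d2 [delta2 [K20 hd2 h2]]]] := p2.
have l20 := ln2_gt0 R; have l21 := ln2_lt1 R.
(* A word is exceptional as soon as one part is, the other being arbitrary, so a saving shrinks by
   the relative length of its part. It stays positive because 0 < alpha < 1. *)
pose delta e := Num.min (alpha * delta1 e) ((1 - alpha) * delta2 e).
exists (K1 + K2 + 3), (d1 + d2)%N, delta; split; first by lra.
  move=> e e0; have /andP[? ?] := hd1 e e0; have /andP[? ?] := hd2 e e0.
  by rewrite /delta lt_min ge_min; apply/andP; split; [apply/andP|apply/orP; left]; nra.
move=> m; pose m1 := Num.truncn (alpha * m%:R).
have am0 : 0 <= alpha * m%:R by rewrite mulr_ge0 // ltW.
have [t1 t2] : m1%:R <= alpha * m%:R /\ alpha * m%:R < m1%:R + 1.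
  by have := truncn_itv am0 => /andP[]; rewrite natr1.
have m0 : 0 <= m%:R :> R by [].
have m1m : (m1 <= m)%N by rewrite -(ler_nat R); nra.
pose m2 := (m - m1)%N; have em : (m1 + m2)%N = m by rewrite subnKC.
have em2 : m2%:R = m%:R - m1%:R :> R by rewrite natrB.
have [F1 [A1 [B1 [hF1 sA1 sB1 hS1]]]] := h1 m1.
have [F2 [A2 [B2 [hF2 sA2 sB2 hS2]]]] := h2 m2.
pose cat2 (P Q : seq (seq bool)) := [seq a ++ b | a <- P, b <- Q].
have mem2 (P Q : seq (seq bool)) a b : a \in P -> b \in Q -> a ++ b \in cat2 P Q.
  by move=> aP bQ; apply/allpairsP; exists (a, b).
have size2 P Q : size (cat2 P Q) = (size P * size Q)%N by rewrite size_allpairs.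
have tk (y : seq bool) : size y = m -> size (take m1 y) = m1.
  by move=> sy; rewrite size_take_min sy; apply/minn_idPl.
have dr (y : seq bool) : size y = m -> size (drop m1 y) = m2 by move=> sy; rewrite size_drop sy.
pose F y := F1 (take m1 y) ++ F2 (drop m1 y).
have sF1 y : size y = m -> size (F1 (take m1 y)) = m1 by move=> sy; have [] := hF1 _ (tk _ sy).
have sF2 y : size y = m -> size (F2 (drop m1 y)) = m2 by move=> sy; have [] := hF2 _ (dr _ sy).
have hammingF y z : size y = m -> size z = m -> hamming (F y) z =
    (hamming (F1 (take m1 y)) (take m1 z) + hamming (F2 (drop m1 y)) (drop m1 z))%N.
  by move=> sy sz; rewrite /F -[in LHS](cat_take_drop m1 z) hamming_cat // sF1 ?tk.
exists F, (cat2 A1 A2), (fun x => cat2 (B1 (take m1 x)) (B2 (drop m1 x))); split.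
- move=> y sy; have [s1 i1 j1] := hF1 _ (tk _ sy); have [s2 i2 j2] := hF2 _ (dr _ sy).
  split; [by rewrite size_cat s1 s2|exact: mem2|].
  rewrite /F take_size_cat // drop_size_cat // -{1}(cat_take_drop m1 y).
  exact: mem2.
- rewrite size2 natrM -em; apply: le_trans (ler_pM _ _ sA1 sA2) _ => //.
  by apply: pexp_prod_le; rewrite natrD; lra.
- move=> x; rewrite size2 natrM -em; apply: le_trans (ler_pM _ _ (sB1 _) (sB2 _)) _ => //.
  by apply: pexp_prod_le; rewrite natrD; lra.
- move=> e e0; have [S1 [sS1 n1 f1]] := hS1 e e0; have [S2 [sS2 n2 f2]] := hS2 e e0.
  exists (cat2 S1 (low m2 m2) ++ cat2 (low m1 m1) S2); split.
  + have /andP[D10 D11] := hd1 e e0; have /andP[D20 D21] := hd2 e e0.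
    have q1 : delta e <= alpha * delta1 e by rewrite /delta ge_min lexx.
    have q2 : delta e <= (1 - alpha) * delta2 e by rewrite /delta ge_min lexx orbT.
    have b1 : (size (cat2 S1 (low m2 m2)))%:R <= pexp (K1 + K2 + 2) (d1 + d2) (1 - delta e) m.
      rewrite size2 natrM -em; apply: le_trans (ler_pM _ _ sS1 (pexp_one_ge _ _)) _ => //.
      apply: (@le_trans _ _ (pexp (K1 + K2 + 2) (d1 + 0) (1 - delta e) (m1 + m2))).
        apply: pexp_prod_le; rewrite em em2.
        have : delta e * m%:R <= delta1 e * m1%:R + 1 by nra.
        by rewrite -(ler_pM2r l20); nra.
      by apply: pexp_mono => //; rewrite leq_add.
    have b2 : (size (cat2 (low m1 m1) S2))%:R <= pexp (K1 + K2 + 2) (d1 + d2) (1 - delta e) m.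
      rewrite size2 natrM -em; apply: le_trans (ler_pM _ _ (pexp_one_ge _ _) sS2) _ => //.
      apply: (@le_trans _ _ (pexp (K1 + K2 + 2) (0 + d2) (1 - delta e) (m1 + m2))).
        apply: pexp_prod_le; rewrite em em2.
        have : delta e * m%:R <= delta2 e * (m%:R - m1%:R) + 1 by nra.
        by rewrite -(ler_pM2r l20); nra.
      by apply: pexp_mono => //; rewrite leq_add.
    rewrite size_cat natrD; apply: le_trans (lerD b1 b2) _.
    have e2 : 2 <= expR (1 : R) by have := expR_ge1Dx (1 : R); lra.
    set P := pexp _ _ _ _; have P0 : 0 <= P by rewrite mulr_ge0 ?expR_ge0 ?exprn_ge0.
    have -> : P + P = 2 * P by lra.
    apply: le_trans (ler_wpM2r P0 e2) _.
    rewrite /P /pexp mulrA -expRD ler_wpM2r ?exprn_ge0 // ler_expR; lra.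
  + move=> y sy; rewrite -{1}(cat_take_drop m1 y) mem_cat negb_or => /andP[y1 y2].
    have z1 : take m1 y \notin S1.
      by apply: contra y1 => ?; apply: mem2 => //; apply: mem_all_strings; exact: dr.
    have z2 : drop m1 y \notin S2.
      by apply: contra y2 => ?; apply: mem2 => //; apply: mem_all_strings; exact: tk.
    have := n1 _ (tk _ sy) z1; have := n2 _ (dr _ sy) z2.
    rewrite (hammingF y y sy sy) natrD em2 => g2 g1.
    have : (r1 - r2) * (m1%:R - alpha * m%:R) <= 1 by nra.
    lra.
  + move=> y z sy sz; rewrite -{1}(cat_take_drop m1 z) mem_cat negb_or => /andP[y1 y2].
    have z1 : take m1 z \notin S1.
      by apply: contra y1 => ?; apply: mem2 => //; apply: mem_all_strings; exact: dr.
    have z2 : drop m1 z \notin S2.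
      by apply: contra y2 => ?; apply: mem2 => //; apply: mem_all_strings; exact: tk.
    have := f1 _ _ (tk _ sy) (tk _ sz) z1; have := f2 _ _ (dr _ sy) (dr _ sz) z2.
    rewrite (hammingF y z sy sz) natrD em2 => g2 g1.
    have : -1 <= (r1 - r2) * (m1%:R - alpha * m%:R) by nra.
    lra.
Qed.

Lemma code_part_exists (R : realType) (s r : R) : 0 <= s <= 1 ->
  Hinv (1 - s) <= r <= 2^-1 - Hinv s -> code_part s r.
Proof.
move=> hs /andP[r1 r2].
have [|ha ea] := @HinvP R (1 - s); first by lra.
have [hp ep] := HinvP hs.
set a := Hinv (1 - s) in ha ea r1; set p := Hinv s in hp ep r2.
have cA := code_part_covering ha ea; have cB := code_part_subsets hp ep.
(* If the interval is a point, [r] is forced, and the quotient [al] would have denominator 0. *)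
have [e|ne] := eqVneq a (2^-1 - p).
  by have -> : r = a by lra.
have lt : 0 < 2^-1 - p - a by rewrite subr_gt0 lt_neqAle ne; lra.
pose al := (2^-1 - p - r) / (2^-1 - p - a).
have -> : r = al * a + (1 - al) * (2^-1 - p).
  have : al * (2^-1 - p - a) = 2^-1 - p - r by rewrite divfK // gt_eqF.
  lra.
apply: code_part_convex => //; first lra.
rewrite divr_ge0 ?ler_pdivrMr ?mul1r //; lra.
Qed.

(** Half of [eps] absorbs exp K and the polynomial factor, the other half the rounding of [beta];
    [m0] is uniform in [t]. *)
Lemma pexp_le_pow2 (R : realType) (K : R) (d : nat) (eps : R) : 0 < eps ->
  exists m0 : nat, forall m, (m0 <= m)%N -> forall t, 0 <= t ->
    exists beta : nat, pexp K d t m <= (2 ^ beta)%:R /\ beta%:R <= (t + eps) * m%:R.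
Proof.
move=> e0; have l20 := ln2_gt0 R.
pose c := eps / 2 * ln 2; have c0 : 0 < c by rewrite mulr_gt0 // divr_gt0.
(* Makes b * (m + 1) <= 1 + c * m / (d + 1), whose power d + 1 is below exp (c * m); the additional
   factor m + 1 beats the constant exp K. *)
pose b := Num.min 1 (c / d.+1%:R).
have b0 : 0 < b by rewrite lt_min ltr01 divr_gt0.
have b1 : b <= 1 by rewrite ge_min lexx.
have bc : b <= c / d.+1%:R by rewrite ge_min lexx orbT.
have key (m : nat) : (b * m.+1%:R) ^+ d.+1 <= expR (c * m%:R).
  apply: (@le_trans _ _ (expR (c / d.+1%:R * m%:R) ^+ d.+1)).
    rewrite lerXn2r ?nnegrE ?expR_ge0 ?mulr_ge0 ?(ltW b0) //.
    apply: le_trans (expR_ge1Dx _); rewrite -natr1 mulrDr mulr1 addrC lerD // ler_wpM2r //.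
  by rewrite -expRM_natl ler_expR mulrA mulrCA divff ?mulr1.
pose M1 := Num.truncn (expR K / b ^+ d.+1); pose M2 := Num.truncn (2 / eps).
exists (maxn M1 M2).+1 => m hm t t0.
have m1 : expR K / b ^+ d.+1 <= m.+1%:R.
  apply: (@le_trans _ _ M1.+1%:R); last by rewrite ler_nat; lia.
  by have /andP[_ /ltW] := @truncn_itv R (expR K / b ^+ d.+1) (ltW (divr_gt0 (expR_gt0 _) (exprn_gt0 _ b0))).
have m2 : 2 / eps <= m%:R.
  apply: (@le_trans _ _ M2.+1%:R); last by rewrite ler_nat; lia.
  have d0 : 0 <= 2 / eps by rewrite divr_ge0 // ltW.
  by have /andP[_ /ltW] := truncn_itv d0.
have em : 1 <= eps / 2 * m%:R.
  by move: m2; rewrite ler_pdivrMr //; lra.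
pose x := (t + eps / 2) * m%:R.
have x0 : 0 <= x by rewrite mulr_ge0 // addr_ge0 // divr_ge0 // ltW.
exists (Num.truncn x).+1; have /andP[x1 x2] := truncn_itv x0; split; last first.
  by rewrite -natr1; rewrite /x in x1; lra.
rewrite natrX -expR_mln2 /pexp.
have poly : expR K * m.+1%:R ^+ d <= expR (c * m%:R).
  apply: le_trans (key m); rewrite exprMn [m.+1%:R ^+ d.+1]exprS mulrA.
  rewrite ler_wpM2r ?exprn_ge0 //.
  by move: m1; rewrite ler_pdivrMr ?exprn_gt0 // mulrC.
rewrite expRD -mulrA; apply: le_trans (ler_wpM2l (expR_ge0 _) poly) _.
rewrite -expRD ler_expR.
have : x * ln 2 <= (Num.truncn x).+1%:R * ln 2 by rewrite ler_wpM2r // ltW.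
rewrite /x /c; lra.
Qed.

(** * Limits and complexity *)

Lemma limn_esup_le (R : realType) (u : nat -> R) (a : R) :
  (forall eta, 0 < eta -> exists n0, forall n, (n0 <= n)%N -> u n <= a + eta) ->
  (limn_esup (fun n => (u n)%:E) <= a%:E)%E.
Proof.
move=> h; apply/lee_addgt0Pr => eta eta0; have [n0 hn0] := h _ eta0.
apply: (@le_trans _ _ (ereal_sup [set (u n)%:E | n in [set n | (n0 <= n)%N]]%classic)).
  apply: ereal_inf_lbound; exists [set n | (n0 <= n)%N]%classic => //.
  by exists n0.
by apply: ge_ereal_sup => _ [n /= hn <-]; rewrite -EFinD lee_fin hn0.
Qed.

Lemma limn_esup_ge (R : realType) (u : nat -> R) (a : R) :
  (forall eta, 0 < eta -> forall n0, exists2 n, (n0 <= n)%N & a - eta <= u n) ->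
  (a%:E <= limn_esup (fun n => (u n)%:E))%E.
Proof.
move=> h; apply: le_ereal_inf_tmp => _ [V [n0 _ hV] <-].
apply/lee_addgt0Pr => eta eta0; have [n n0n hn] := h _ eta0 n0.
rewrite -leeBlDr //; apply: (@le_trans _ _ (u n)%:E).
  by rewrite -EFinB lee_fin.
by apply: ereal_sup_ubound; exists n => //; exact: hV.
Qed.

Lemma limn_esup_lt (R : realType) (u : nat -> R) (a : R) :
  (limn_esup (fun n => (u n)%:E) < a%:E)%E ->
  exists n0, forall n, (n0 <= n)%N -> u n < a.
Proof.
move=> /ereal_inf_lt[_ [V [n0 _ hV] <-] h]; exists n0 => n n0n.
rewrite -lte_fin; apply: le_lt_trans h; apply: ereal_sup_ubound.
by exists n => //; exact: hV.
Qed.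

Lemma limn_einf_gt (R : realType) (u : nat -> R) (a b : R) :
  limn_einf (fun n => (u n)%:E) = a%:E -> b < a ->
  exists n0, forall n, (n0 <= n)%N -> b < u n.
Proof.
move=> h ba.
have [n0 hn0] : exists n0, forall n, (n0 <= n)%N -> - u n < - b.
  apply: limn_esup_lt.
  have := limn_esupN (fun n => (u n)%:E); rewrite h /comp => ->.
  by rewrite lte_fin ltrN2.
by exists n0 => n /hn0; rewrite ltrN2.
Qed.

Lemma limn_einf_esup_eq (R : realType) (u : nat -> R) (a : R) :
  (forall eta, 0 < eta -> exists n0, forall n, (n0 <= n)%N -> a - eta <= u n <= a + eta) ->
  limn_einf (fun n => (u n)%:E) = a%:E /\ limn_esup (fun n => (u n)%:E) = a%:E.
Proof.
move=> h; split.
  apply/oppe_inj; rewrite -limn_esupN /comp.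
  have -> : (fun n => (- (u n)%:E)%E) = (fun n => (- u n)%:E) by [].
  apply/eqP; rewrite eq_le; apply/andP; split.
    apply: limn_esup_le => eta /h[n0 hn0]; exists n0 => n /hn0 /andP[]; lra.
  apply: limn_esup_ge => eta /h[n0 hn0] n1; exists (maxn n0 n1); first exact: leq_maxr.
  by have /andP[] := hn0 _ (leq_maxl n0 n1); lra.
apply/eqP; rewrite eq_le; apply/andP; split.
  by apply: limn_esup_le => eta /h[n0 hn0]; exists n0 => n /hn0 /andP[].
apply: limn_esup_ge => eta /h[n0 hn0] n1; exists (maxn n0 n1); first exact: leq_maxr.
by have /andP[] := hn0 _ (leq_maxl n0 n1).
Qed.

Lemma KU_le (R : realType) U sigma n : kol_le U sigma n -> KU U sigma <= n%:R :> R.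
Proof.
move=> [p [hp sp]]; apply: (@le_trans _ _ (size p)%:R); last by rewrite ler_nat.
apply: ge_inf; last by exists p.
by exists 0 => _ [q _ <-].
Qed.

(** The identity code describes every word by its own number, so the infimum is taken over a
    nonempty set of naturals. *)
Lemma KU_attained (R : realType) U sigma : optimal_pf_machine U ->
  exists2 n, kol_le U sigma n & KU U sigma = n%:R :> R.
Proof.
move=> hU; have [c hc] := kol_le_payload hU PId 1.
have [|p0 [hp0 _]] := hc (benc sigma) (benc sigma) sigma (ev_id _).
  by rewrite mul1n ltn_expl.
have ex : exists n, `[< exists2 p, describes U p sigma & size p = n >].
  by exists (size p0); apply/asboolP; exists p0.
case: (ex_minnP ex) => n /asboolP[p hp sp] hmin.
have kn : kol_le U sigma n by exists p; rewrite sp.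
exists n => //; apply/eqP; rewrite eq_le KU_le //=.
apply: lb_le_inf; first by exists (size p)%:R; exists p.
move=> _ [q hq <-]; rewrite ler_nat; apply: hmin; apply/asboolP.
by exists q.
Qed.

Lemma hdist_hamming (R : realType) (X Y : nat -> bool) n :
  (#|[set m : 'I_n | X m != Y m]%classic|)%:R = (hamming (restr X n) (restr Y n))%:R :> R.
Proof.
congr _%:R; rewrite /restr /mkseq -val_enum_ord -!map_comp.
rewrite /hamming /bxor zip_map -map_comp /weight count_map.
rewrite -sum1_card -sum1_count -enumT big_enum_cond; apply: eq_bigl => i.
have -> : (i \in [set m : 'I_n | X m != Y m]%classic) = (X i != Y i).
  by apply/idP/idP; rewrite inE.
by rewrite /=; case: (X i) (Y i) => [] [].
Qed.

(** * Stages *)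

(* The data of [code_part] for one block length [sm], with [sS e] at tolerance
   [1 / (e + 1)] and [sb1], [sb2], [sb3 e] the binary logarithms of the sizes. *)
Record stage := Stage {
  sm : nat;
  sF : seq bool -> seq bool;
  sL1 : seq (seq bool);
  sL2 : seq bool -> seq (seq bool);
  sS : nat -> seq (seq bool);
  sb1 : nat;
  sb2 : nat;
  sb3 : nat -> nat }.

Definition eps {R : realType} (k : nat) : R := k.+1%:R^-1.

Lemma eps_gt0 (R : realType) k : 0 < eps k :> R.
Proof. by rewrite invr_gt0. Qed.

Lemma eps_mul (R : realType) k : eps k * k.+1%:R = 1 :> R.
Proof. by rewrite mulVf // pnatr_eq0. Qed.

Lemma eps_small (R : realType) (eta : R) : 0 < eta ->
  exists k0, forall k, (k0 <= k)%N -> eps k <= eta.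
Proof.
move=> eta0; exists (Num.truncn eta^-1) => k hk.
rewrite -[eta]invrK lef_pV2 ?posrE ?invr_gt0 //.
apply: (@le_trans _ _ (Num.truncn eta^-1).+1%:R); last by rewrite ler_nat.
have i0 : 0 <= eta^-1 by rewrite invr_ge0 ltW.
by have /andP[_ /ltW] := truncn_itv i0.
Qed.

(** [delta] depends on the tolerance alone, and stage [k] answers for the finitely many e <= k. The
    number 2 * k + 3 bounds the class tags in use up to stage [k], which must be short against a
    block. *)
Definition stage_ok {R : realType} (s r : R) (delta : nat -> R) (k : nat) (st : stage) :=
  [/\ (0 < sm st)%N /\ (2 * k + 3)%N%:R <= eps k * (sm st)%:R :> R,
      forall y, size y = sm st ->
        [/\ size (sF st y) = sm st, sF st y \in sL1 st & y \in sL2 st (sF st y)],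
      (size (sL1 st) <= 2 ^ sb1 st)%N /\ (sb1 st)%:R <= (s + eps k) * (sm st)%:R,
      (forall x, size (sL2 st x) <= 2 ^ sb2 st)%N /\
        (sb2 st)%:R <= (1 - s + eps k) * (sm st)%:R &
      forall e, (e <= k)%N ->
        [/\ (size (sS st e) <= 2 ^ sb3 st e)%N,
            (sb3 st e)%:R <= (1 - delta e) * (sm st)%:R,
            forall y, size y = sm st -> y \notin sS st e ->
              (hamming (sF st y) y)%:R <= (r + eps e) * (sm st)%:R &
            forall y z, size y = sm st -> size z = sm st -> z \notin sS st e ->
              (r - eps e) * (sm st)%:R <= (hamming (sF st y) z)%:R]].

Lemma stages_exist (R : realType) (s r : R) : 0 <= s <= 1 -> code_part s r ->
  exists (delta : nat -> R) (st : nat -> stage),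
    (forall e, 0 < delta e) /\ forall k, stage_ok s r delta k (st k).
Proof.
move=> hs [K [d [D [K0 hD h]]]].
(* Half of the tolerance is kept for the additive constant [K], and half of the saving [D] for the
   constant and polynomial factors in [pexp]. *)
pose he e : R := eps e / 2; have he0 e : 0 < he e by rewrite divr_gt0 // eps_gt0.
pose delta e := D (he e) / 2.
have d0 e : 0 < delta e by have /andP[? _] := hD _ (he0 e); rewrite divr_gt0.
exists delta; suff /choice[st hst] : forall k, exists st, stage_ok s r delta k st.
  by exists st.
move=> k.
have [n1 hn1] := pexp_le_pow2 K d (eps_gt0 R k).
have /choice[n2 hn2] e := pexp_le_pow2 K d (d0 e).
pose M := Num.truncn (2 * k.+1%:R * (K + (2 * k + 3)%N%:R)).
pose m := (n1 + \max_(e < k.+1) n2 e + M.+1)%N.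
have [F [L1 [L2 [hF s1 s2 hS]]]] := h m.
have [|b1 [b11 b12]] := hn1 m _ s (ltac:(lra)); first by lia.
have [|b2 [b21 b22]] := hn1 m _ (1 - s) (ltac:(lra)); first by lia.
have /choice[S hS'] e := hS _ (he0 e).
have /choice[b3 hb3] : forall e, exists b : nat, (e <= k)%N ->
    (size (S e) <= 2 ^ b)%N /\ b%:R <= (1 - delta e) * m%:R.
  move=> e; have [ek|ek] := boolP (e <= k)%N; last by exists 0%N.
  have le2 : (n2 e <= m)%N.
    have : (n2 (Ordinal (ek : e < k.+1)%N) <= \max_(e < k.+1) n2 e)%N by exact: leq_bigmax.
    move=> /= le2; apply: leq_trans le2 _.
    by rewrite /m addnAC leq_addl.
  have /andP[_ D1] := hD _ (he0 e).
  have [b [hb1 hb2]] := hn2 e m le2 (1 - D (he e)) ltac:(lra).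
  exists b => _; split; last by move: hb2; rewrite /delta; lra.
  by have [h1 _ _] := hS' e; rewrite -(ler_nat R); exact: le_trans h1 hb1.
have bigM : 2 * k.+1%:R * (K + (2 * k + 3)%N%:R) <= m%:R.
  have p0 : 0 <= 2 * k.+1%:R * (K + (2 * k + 3)%N%:R) by rewrite !mulr_ge0 // addr_ge0.
  have /andP[_ /ltW hM] := truncn_itv p0.
  by apply: le_trans hM _; rewrite ler_nat leq_addl.
have ek0 := eps_gt0 R k; have ek1 := eps_mul R k.
have kk : K + (2 * k + 3)%N%:R <= he k * m%:R.
  apply: le_trans (ler_wpM2l (ltW (he0 k)) bigM).
  by rewrite /he !mulrA divfK ?pnatr_eq0 // ek1 mul1r.
have em0 : 0 <= eps k * m%:R :> R by rewrite mulr_ge0 // ltW.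
have k30 : 0 <= (2 * k + 3)%N%:R :> R by [].
exists (Stage m F L1 L2 S b1 b2 b3); split => //=.
- split; first by rewrite /m addnS.
  by move: kk; rewrite /he; lra.
- by split=> //; rewrite -(ler_nat R); exact: le_trans s1 b11.
- by split=> // x; rewrite -(ler_nat R); exact: le_trans (s2 x) b21.
- move=> e ek; have [hb31 hb32] := hb3 e ek; have [_ near far] := hS' e.
  have eK : K <= he e * m%:R.
    have : he k * m%:R <= he e * m%:R.
      rewrite ler_wpM2r // /he ler_wpM2r // ?invr_ge0 // /eps lef_pV2 ?posrE //.
      by rewrite ler_nat ltnS.
    lra.
  split=> //.
    by move=> y sy yS; apply: le_trans (near y sy yS) _; move: eK; rewrite /he; lra.
  by move=> y z sy sz zS; apply: le_trans (far y z sy sz zS); move: eK; rewrite /he; lra.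
Qed.

(** * Blockwise encoding of a sequence *)

Local Open Scope nat_scope.

(** [kk j] is the last stage whose constant is affordable after [j] blocks: as these have length at
    least [j], the constant is at most a fraction 1/(k + 1) of the position, with k = [kk j]. *)
Lemma slow_stage (kappa : nat -> nat) : exists kk : nat -> nat,
  [/\ {homo kk : i j / i <= j},
      (forall k, exists j0, forall j, j0 <= j -> k <= kk j) &
      (exists j0, forall j, j0 <= j -> (kk j).+1 * kappa (kk j) <= j)].
Proof.
pose Kb k := \sum_(i < k.+1) kappa i.
pose kk j := \max_(k < j.+1 | k.+1 * Kb k <= j) (k : nat).
exists kk; split.
- move=> i j ij; apply/bigmax_leqP => k hk.
  have kj : k < j.+1 by apply: leq_trans (ltn_ord k) _.
  apply: (@leq_bigmax_cond _ (fun k : 'I_j.+1 => k.+1 * Kb k <= j) (fun k => k : nat) (Ordinal kj)).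
  exact: leq_trans hk ij.
- move=> k; exists (maxn k (k.+1 * Kb k)) => j; rewrite geq_max => /andP[h1 h2].
  exact: (@leq_bigmax_cond _ (fun k : 'I_j.+1 => k.+1 * Kb k <= j) (fun k => k : nat)
    (Ordinal (h1 : k < j.+1))).
(* From here on k = 0 qualifies, so the maximum is attained and is not the default value of an empty
   one. *)
- exists (Kb 0) => j hj.
  have [k hk e] := @eq_bigmax_cond _ (fun k : 'I_j.+1 => k.+1 * Kb k <= j) (fun k => k : nat)
    ltac:(by apply/card_gt0P; exists ord0; rewrite unfold_in /= mul1n).
  rewrite /kk e; apply: leq_trans hk; rewrite leq_mul2l /Kb big_ord_recr /=.
  exact: leq_addl.
Qed.

Section Blocks.
Context (st : nat -> stage) (kk : nat -> nat).

Definition blen j := sm (st (kk j)).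
Definition pos J := \sum_(j < J) blen j.
Definition blk (Z : nat -> bool) j := mkseq (fun i => Z (pos j + i)) (blen j).

Lemma posS J : pos J.+1 = pos J + blen J.
Proof. exact: big_ord_recr. Qed.

Lemma pos_mono I J : I <= J -> pos I <= pos J.
Proof.
move=> h; rewrite -(subnKC h); elim: (J - I) => [|n IH]; first by rewrite addn0.
by rewrite addnS posS (leq_trans IH) // leq_addr.
Qed.

Lemma restrD (Z : nat -> bool) a b : restr Z (a + b) = restr Z a ++ mkseq (fun i => Z (a + i)) b.
Proof. by rewrite /restr /mkseq iotaD map_cat add0n -[a in iota a b]addn0 iotaDl -map_comp. Qed.

Lemma restr_pos Z J : restr Z (pos J) = flatten [seq blk Z j | j <- iota 0 J].
Proof.
elim: J => [|J IH]; first by rewrite /pos big_ord0.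
by rewrite posS restrD IH -addn1 iotaD map_cat flatten_cat /= cats0 add0n.
Qed.

Lemma size_blk Z j : size (blk Z j) = blen j.
Proof. by rewrite size_mkseq. Qed.

Lemma pos_ge J : (forall k, 0 < sm (st k)) -> J <= pos J.
Proof.
move=> h; elim: J => // J IH; rewrite posS -addn1 leq_add //; exact: h.
Qed.

Lemma pos_locate n : (forall k, 0 < sm (st k)) -> exists J t, n = pos J + t /\ t < blen J.
Proof.
move=> h; elim: n => [|n [J [t [-> lt]]]].
  by exists 0, 0; rewrite /pos big_ord0; split=> //; exact: h.
have [e|ne] := eqVneq t.+1 (blen J).
  by exists J.+1, 0; rewrite posS -e addnS addn0; split=> //; exact: h.
by exists J, t.+1; rewrite addnS; split=> //; rewrite ltn_neqAle ne.
Qed.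

Lemma hamming_restr_pos (Z W : nat -> bool) J :
  hamming (restr Z (pos J)) (restr W (pos J)) = \sum_(j < J) hamming (blk Z j) (blk W j).
Proof.
elim: J => [|J IH]; first by rewrite /pos !big_ord0.
by rewrite posS !restrD hamming_cat ?size_mkseq // IH big_ord_recr.
Qed.

Definition enc_prefix (Y : nat -> bool) J :=
  flatten [seq sF (st (kk j)) (blk Y j) | j <- iota 0 J].

(** For nonempty blocks, [n + 1] of them reach beyond position [n]. *)
Definition enc_seq (Y : nat -> bool) n := nth false (enc_prefix Y n.+1) n.

Lemma blk_enc_seq Y : (forall k, 0 < sm (st k)) ->
  (forall k y, size y = sm (st k) -> size (sF (st k) y) = sm (st k)) ->
  forall j, blk (enc_seq Y) j = sF (st (kk j)) (blk Y j).
Proof.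
move=> h hF j.
have sE J : size (enc_prefix Y J) = pos J.
  elim: J => [|J IH]; first by rewrite /pos big_ord0.
  rewrite /enc_prefix -addn1 iotaD map_cat flatten_cat size_cat -/(enc_prefix Y J) IH /=.
  by rewrite cats0 add0n hF ?size_blk // addn1 posS.
have ext I J n : I <= J -> n < pos I -> nth false (enc_prefix Y J) n = nth false (enc_prefix Y I) n.
  move=> IJ ln; rewrite -(subnKC IJ) /enc_prefix iotaD map_cat flatten_cat nth_cat.
  by rewrite -/(enc_prefix Y I) sE ln.
have sj : size (sF (st (kk j)) (blk Y j)) = blen j by rewrite hF // size_blk.
apply: (@eq_from_nth _ false); rewrite size_blk // => i lt.
rewrite nth_mkseq // /enc_seq.
have e1 : nth false (enc_prefix Y (pos j + i).+1) (pos j + i) =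
    nth false (enc_prefix Y j.+1) (pos j + i).
  apply: ext; last by rewrite posS ltn_add2l.
  by rewrite ltnS (leq_trans (pos_ge j h)) // leq_addr.
rewrite e1 /enc_prefix -addn1 iotaD map_cat flatten_cat nth_cat -/(enc_prefix Y j) sE.
by rewrite ltnNge leq_addr /= addKn cats0 add0n.
Qed.

(** A prefix may end inside a block: its last [t] bits are coded one by one in class 0. *)
Definition mkblocks (cls : nat -> nat) (W Z : nat -> bool) J t : seq block :=
  [seq (cls j, (blk W j, blk Z j)) | j <- iota 0 J] ++
  [seq (0, ([:: W (pos J + i)], [:: Z (pos J + i)])) | i <- iota 0 t].

Lemma flatten_singletons (T : Type) (f : nat -> T) (l : seq nat) :
  flatten [seq [:: f i] | i <- l] = [seq f i | i <- l].
Proof. by elim: l => //= i l ->. Qed.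

Lemma mkblocks_y cls W Z J t :
  flatten (map by_ (mkblocks cls W Z J t)) = restr Z (pos J + t).
Proof.
rewrite map_cat flatten_cat restrD restr_pos -!map_comp; congr (_ ++ _).
exact: flatten_singletons.
Qed.

Lemma mkblocks_x cls W Z J t :
  flatten (map bx (mkblocks cls W Z J t)) = restr W (pos J + t).
Proof.
rewrite map_cat flatten_cat restrD restr_pos -!map_comp; congr (_ ++ _).
exact: flatten_singletons.
Qed.

Lemma mkblocks_cost beta cls W Z J t : beta 0 = 1 ->
  \sum_(b <- mkblocks cls W Z J t) bcost beta b =
  \sum_(j < J) (cls j + 1 + beta (cls j)) + 2 * t.
Proof.
move=> b0; rewrite big_cat !big_map /= -{1}[J in iota 0 J]subn0 -/(index_iota 0 J) big_mkord.
congr (_ + _).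
under eq_bigr do rewrite /bcost /= b0.
by rewrite big_const_seq count_predT size_iota iter_addn_0.
Qed.

Lemma mkblocks_zero cls Z J t mm : mm 0 = 1 -> (forall j, j < J -> mm (cls j) = blen j) ->
  forall b, b \in mkblocks cls (fun=> false) Z J t -> bx b = nseq (mm b.1) false.
Proof.
move=> m0 hm b; rewrite mem_cat => /orP[] /mapP[j]; rewrite mem_iota add0n => /= lj ->.
  rewrite /bx /= hm //; apply: (@eq_from_nth _ false); rewrite size_blk ?size_nseq // => i lt.
  by rewrite nth_mkseq // nth_nseq lt.
by rewrite /bx /= m0.
Qed.

Lemma mkblocks_valid mm beta lst C cls W Z J t :
  0 < C -> mm 0 = 1 -> beta 0 = 1 -> (forall x, lst 0 x = [:: [:: true]; [:: false]]) ->
  (forall j, j < J -> [/\ cls j < C, mm (cls j) = blen j,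
     blk Z j \in lst (cls j) (blk W j) &
     size (lst (cls j) (blk W j)) <= 2 ^ beta (cls j)]) ->
  all (vblock mm beta lst C) (mkblocks cls W Z J t).
Proof.
move=> C0 m0 b0 l0 h; rewrite all_cat; apply/andP; split; apply/allP => b /mapP[j].
  rewrite mem_iota add0n => /= /h[h1 h2 h3 h4] ->.
  by rewrite /vblock /bx /by_ /= h1 !size_blk h2 eqxx h3 h4.
move=> _ ->; rewrite /vblock /bx /by_ /= C0 m0 l0 b0 /=.
by case: (Z _).
Qed.

End Blocks.

Local Open Scope ring_scope.

Lemma sum_eventually (R : realType) (a b : nat -> R) j0 :
  (forall j, (j0 <= j)%N -> a j <= b j) ->
  exists2 C : R, 0 <= C & forall J, \sum_(j < J) a j <= \sum_(j < J) b j + C.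
Proof.
move=> h; exists (\sum_(j < j0) `|a j - b j|); first by rewrite sumr_ge0.
move=> J; rewrite -lerBlDl -sumrB.
have -> : \sum_(j < J) (a j - b j) = \sum_(0 <= j < J) (a j - b j) by rewrite big_mkord.
have -> : \sum_(j < j0) `|a j - b j| = \sum_(0 <= j < j0) `|a j - b j| by rewrite big_mkord.
have [Jj|jJ] := leqP J j0.
  rewrite (big_cat_nat (n := J) (p := j0)) //= ler_wpDr ?sumr_ge0 //.
  by apply: ler_sum => j _; exact: ler_norm.
rewrite (big_cat_nat (n := j0) (p := J)) //=; last exact: ltnW.
rewrite -[leRHS]addr0 lerD //.
  by apply: ler_sum => j _; exact: ler_norm.
rewrite big_nat_cond sumr_le0 // => j /andP[/andP[hj _] _].
by rewrite subr_le0 h.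
Qed.

Lemma natr_large (R : realType) (C eta : R) : 0 < eta ->
  exists n0 : nat, forall n, (n0 <= n)%N -> C <= eta * n%:R.
Proof.
move=> eta0; exists (Num.truncn `|C / eta|).+1 => n hn.
have /andP[_ h] := truncn_itv (normr_ge0 (C / eta)).
rewrite mulrC -ler_pdivrMr //; apply: le_trans (ler_norm _) _.
apply: (le_trans (ltW h)); by rewrite ler_nat.
Qed.

(* Block [j] is encoded by stage [kk j]; [kappa k] stands for the machine-dependent
   constant of the decoder with the tables of the stages up to [k]. *)
Definition slow (st : nat -> stage) (kappa kk : nat -> nat) :=
  [/\ (forall k, (0 < sm (st k) <= kappa k)%N), {homo kk : i j / (i <= j)%N},
      (forall k, exists j0, forall j, (j0 <= j)%N -> (k <= kk j)%N) &
      (exists j0, forall j, (j0 <= j)%N -> ((kk j).+1 * kappa (kk j) <= j)%N)].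

Lemma pos_natr (R : realType) st kk J :
  (pos st kk J)%:R = \sum_(j < J) (blen st kk j)%:R :> R.
Proof. exact: natr_sum. Qed.

(** The unfinished block is negligible because [slow] bounds its length by [kappa]. *)
Lemma slow_eventually (R : realType) st kappa kk (eta : R) : slow st kappa kk -> 0 < eta ->
  exists n0, forall J t, (t < blen st kk J)%N -> (n0 <= pos st kk J + t)%N ->
   [/\ eps (kk J) <= eta,
       (kappa (kk J))%:R <= eta * (pos st kk J + t)%:R :> R &
       t%:R <= eta * (pos st kk J + t)%:R :> R].
Proof.
move=> [hs mono unb [j0 hj0]] eta0.
have sm0 k : (0 < sm (st k))%N by have /andP[] := hs k.
have [k0 hk0] := eps_small eta0; have [j1 hj1] := unb k0.
exists (pos st kk (maxn j0 j1).+1) => J t lt hn.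
have Jl : (maxn j0 j1 <= J)%N.
  rewrite -ltnS ltnNge; apply/negP => JS.
  have : (pos st kk J.+1 <= pos st kk (maxn j0 j1).+1)%N.
    by apply: pos_mono; apply: leqW.
  by rewrite posS; lia.
have eJ : eps (kk J) <= eta by apply: hk0; apply: hj1; lia.
have kJ := hj0 J ltac:(lia).
have Jn : (J <= pos st kk J + t)%N by apply: leq_trans (pos_ge kk J sm0) (leq_addr _ _).
have kn : (kappa (kk J))%:R <= eta * (pos st kk J + t)%:R :> R.
  have : ((kk J).+1 * kappa (kk J))%N%:R <= (pos st kk J + t)%:R :> R.
    by rewrite ler_nat (leq_trans kJ).
  rewrite natrM => h; have h' := ler_wpM2l (ltW (eps_gt0 R (kk J))) h.
  rewrite mulrA eps_mul mul1r in h'; apply: (le_trans h').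
  by rewrite ler_wpM2r.
split=> //; apply: le_trans kn; rewrite ler_nat ltnW //.
by apply: leq_trans lt _; have /andP[] := hs (kk J).
Qed.

Lemma cost_rate (R : realType) st kappa kk (a : nat -> R) (c eta : R) :
  slow st kappa kk -> 0 < eta -> 0 <= c ->
  (exists j0, forall j, (j0 <= j)%N -> a j <= (c + 2 * eps (kk j)) * (blen st kk j)%:R) ->
  exists n0, forall J t, (t < blen st kk J)%N -> (n0 <= pos st kk J + t)%N ->
    \sum_(j < J) a j + (2 * t)%:R <= (c + eta) * (pos st kk J + t)%:R.
Proof.
move=> hs eta0 c0 [j0 hj0]; pose e4 := eta / 4.
have e40 : 0 < e4 by rewrite divr_gt0.
have e8 : 0 < eta / 8 by rewrite divr_gt0.
have [n1 hn1] := slow_eventually hs e40.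
have [_ _ unb _] := hs.
have [k0 hk0] := eps_small e8; have [j1 hj1] := unb k0.
have [|C C0 hC] := @sum_eventually R a (fun j => (c + e4) * (blen st kk j)%:R) (maxn j0 j1).
  move=> j; rewrite geq_max => /andP[h0 h1]; apply: le_trans (hj0 j h0) _.
  by rewrite ler_wpM2r // lerD2l; have := hk0 _ (hj1 j h1); rewrite /e4; lra.
have [n2 hn2] := natr_large C e40.
exists (maxn n1 n2) => J t lt; rewrite geq_max => /andP[m1 m2].
have [_ _ ht] := hn1 J t lt m1; have hc := hn2 _ m2.
have := hC J; rewrite -mulr_sumr -pos_natr natrM.
move: ht hc; rewrite natrD; set p := (pos _ _ _)%:R; set u := t%:R => ht hc h.
have u0 : 0 <= u by []. have p0 : 0 <= p by [].
rewrite /e4 in ht hc h; nra.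
Qed.

(** [T] is a saving carried along with the cost [W]. The main part of 18 comes from 3 * eps k * W
    with c <= 4. *)
Lemma rate_bound (R : realType) (eta c n W T N K : R) k :
  0 < eta <= 1 -> 0 <= c <= 4 -> 0 <= n -> 0 <= W -> 0 <= T -> eps k <= eta ->
  W + T <= (c + eta) * n -> K <= eta * n -> 0 <= K ->
  k.+1%:R * N <= (k.+1 + 3)%:R * W + K -> N + T <= (c + 18 * eta) * n.
Proof.
move=> /andP[eta0 eta1] /andP[c0 c2] n0 W0 T0 ek hW hK K0 h.
have e0 := eps_gt0 R k.
have e1 : eps k <= 1 :> R by exact: le_trans ek eta1.
have h1 : N <= W + 3 * eps k * W + eps k * K.
  have := ler_wpM2l (ltW e0) h; rewrite mulrA eps_mul mul1r natrD mulrDr !mulrA mulrDr eps_mul.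
  lra.
have h2 : eps k * W <= eta * ((c + eta) * n) by apply: ler_pM => //; [exact: ltW|lra].
have h3 : eps k * K <= eta * n by apply: le_trans hK; rewrite ler_piMl.
have h4 : eta * (c * n) <= 4 * (eta * n).
  by rewrite mulrCA ler_wpM2r // mulr_ge0 // ltW.
have h5 : eta * (eta * n) <= eta * n by rewrite ler_piMl // mulr_ge0 // ltW.
lra.
Qed.

(** * Complexity rates *)

Definition raw_class (mm beta : nat -> nat) (lst : nat -> seq bool -> seq (seq bool)) :=
  [/\ mm 0 = 1, beta 0 = 1 & forall x, lst 0 x = [:: [:: true]; [:: false]]]%N.

(** The weights [w] record by how much the blocks undercut the rate [c]; with them the bound also
    shows that compressible blocks are rare. *)
Lemma KU_rate (R : realType) U st kappa kk mm beta lst (cls : nat -> nat)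
    (Z : nat -> bool) (w : nat -> R) (c : R) :
  slow st kappa kk -> raw_class mm beta lst ->
  (forall k bs, all (vblock mm beta lst (2 * k + 3)) bs ->
     (forall b, b \in bs -> bx b = nseq (mm b.1) false) ->
     exists n, kol_le U (flatten (map by_ bs)) n /\
       (k.+1 * n <= (k.+1 + 3) * (\sum_(b <- bs) bcost beta b) + kappa k)%N) ->
  (forall j, [/\ (cls j < 2 * kk j + 3)%N, mm (cls j) = blen st kk j,
     blk st kk Z j \in lst (cls j) (blk st kk (fun=> false) j) &
     (size (lst (cls j) (blk st kk (fun=> false) j)) <= 2 ^ beta (cls j))%N]) ->
  0 <= c <= 4 -> (forall j, 0 <= w j) ->
  (exists j0, forall j, (j0 <= j)%N -> (cls j + 1 + beta (cls j))%N%:R + w j <=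
     (c + 2 * eps (kk j)) * (blen st kk j)%:R) ->
  forall eta, 0 < eta -> exists n0, forall J t, (t < blen st kk J)%N ->
    (n0 <= pos st kk J + t)%N ->
    KU U (restr Z (pos st kk J + t)) + \sum_(j < J) w j <=
      (c + eta) * (pos st kk J + t)%:R.
Proof.
move=> hs [m0 b0 l0] hk hcls c04 w0 hw eta eta0.
pose e1 := Num.min 1 (eta / 18).
have e10 : 0 < e1 by rewrite lt_min ltr01 divr_gt0.
have e11 : e1 <= 1 by rewrite ge_min lexx.
have e1e : 18 * e1 <= eta.
  have : e1 <= eta / 18 by rewrite ge_min lexx orbT.
  by rewrite ler_pdivlMr // mulrC.
have c0 : 0 <= c by have /andP[] := c04.
have [n1 hn1] := cost_rate hs e10 c0 hw.
have [n2 hn2] := slow_eventually hs e10.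
exists (maxn n1 n2) => J t lt; rewrite geq_max => /andP[h1 h2].
have hW := hn1 J t lt h1; have [he hK _] := hn2 J t lt h2.
have [_ mono _ _] := hs.
have [||n [hn nb]] := hk (kk J) (mkblocks st kk cls (fun=> false) Z J t).
- apply: mkblocks_valid => //; first lia.
  move=> j jJ; have [q1 q2 q3 q4] := hcls j; split=> //.
  by apply: leq_trans q1 _; rewrite leq_add2r leq_mul2l mono ?orbT // ltnW.
- by apply: mkblocks_zero => // j _; have [] := hcls j.
rewrite mkblocks_y in hn; rewrite mkblocks_cost // in nb.
set P := (pos st kk J + t)%N in hW hK hn *.
set W := (_ + 2 * t)%N in nb.
have hWR : W%:R + \sum_(j < J) w j <= (c + e1) * P%:R.
  by rewrite /W natrD natr_sum addrAC -big_split.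
have T0 : 0 <= \sum_(j < J) w j by apply: sumr_ge0.
have nbR : (kk J).+1%:R * n%:R <= ((kk J).+1 + 3)%:R * W%:R + (kappa (kk J))%:R :> R.
  by rewrite -!natrM -natrD ler_nat.
have e01 : 0 < e1 <= 1 by rewrite e10.
have := rate_bound e01 c04 (ler0n _ P) (ler0n _ W) T0 he hWR hK (ler0n _ _) nbR.
have := @KU_le R _ _ _ hn => g1 g2.
have : (c + 18 * e1) * P%:R <= (c + eta) * P%:R by rewrite ler_wpM2r // lerD2l.
lra.
Qed.

Lemma KU_rate_cond (R : realType) U (hU : optimal_pf_machine U) st kappa kk mm beta lst
    (cls : nat -> nat) (X Y : nat -> bool) (c : R) :
  slow st kappa kk -> raw_class mm beta lst ->
  (forall k bs, all (vblock mm beta lst (2 * k + 3)) bs ->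
     forall K, kol_le U (flatten (map bx bs)) K ->
     exists n, kol_le U (flatten (map by_ bs)) n /\
       (k.+1 * n <= (k.+1 + 3) * (K + \sum_(b <- bs) bcost beta b) + kappa k)%N) ->
  (forall j, [/\ (cls j < 2 * kk j + 3)%N, mm (cls j) = blen st kk j,
     blk st kk Y j \in lst (cls j) (blk st kk X j) &
     (size (lst (cls j) (blk st kk X j)) <= 2 ^ beta (cls j))%N]) ->
  0 <= c <= 1 ->
  (exists j0, forall j, (j0 <= j)%N -> (cls j + 1 + beta (cls j))%N%:R <=
     (c + 2 * eps (kk j)) * (blen st kk j)%:R) ->
  (exists n0, forall n, (n0 <= n)%N -> KU U (restr X n) <= 2 * n%:R :> R) ->
  forall eta, 0 < eta -> exists n0, forall J t, (t < blen st kk J)%N ->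
    (n0 <= pos st kk J + t)%N ->
    KU U (restr Y (pos st kk J + t)) <=
      KU U (restr X (pos st kk J + t)) + (c + eta) * (pos st kk J + t)%:R.
Proof.
move=> hs [m0 b0 l0] hk hcls /andP[c0 c1] hw [n3 hn3] eta eta0.
pose e1 := Num.min 1 (eta / 18).
have e10 : 0 < e1 by rewrite lt_min ltr01 divr_gt0.
have e11 : e1 <= 1 by rewrite ge_min lexx.
have e1e : 18 * e1 <= eta.
  have : e1 <= eta / 18 by rewrite ge_min lexx orbT.
  by rewrite ler_pdivlMr // mulrC.
have [n1 hn1] := cost_rate hs e10 c0 hw.
have [n2 hn2] := slow_eventually hs e10.
exists (maxn n3 (maxn n1 n2)) => J t lt; rewrite !geq_max => /and3P[h3 h1 h2].
have hW := hn1 J t lt h1; have [he hK _] := hn2 J t lt h2.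
have [_ mono _ _] := hs.
set P := (pos st kk J + t)%N in hW hK h3 *.
have [K kK eK] := @KU_attained R U (restr X P) hU.
have [||n [hn nb]] := hk (kk J) (mkblocks st kk cls X Y J t) _ K.
- apply: mkblocks_valid => //; first lia.
  move=> j jJ; have [q1 q2 q3 q4] := hcls j; split=> //.
  by apply: leq_trans q1 _; rewrite leq_add2r leq_mul2l mono ?orbT // ltnW.
- by rewrite mkblocks_x.
rewrite mkblocks_y in hn; rewrite mkblocks_cost // in nb.
set W := (_ + 2 * t)%N in nb.
have hWR : W%:R <= (c + e1) * P%:R by rewrite /W natrD natr_sum.
have nbR : (kk J).+1%:R * n%:R <= ((kk J).+1 + 3)%:R * (K + W)%:R + (kappa (kk J))%:R :> R.
  by rewrite -!natrM -natrD ler_nat.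
have e01 : 0 < e1 <= 1 by rewrite e10.
have K2 := hn3 P h3; rewrite eK in K2.
have P0 : 0 <= P%:R :> R by [].
have T0 : 0 <= 2 * P%:R - K%:R :> R by lra.
have c24 : 0 <= c + 2 <= 4 by lra.
have hKW : (K + W)%:R + (2 * P%:R - K%:R) <= (c + 2 + e1) * P%:R.
  by rewrite natrD; lra.
have := rate_bound e01 c24 P0 (ler0n _ (K + W)) T0 he hKW hK (ler0n _ _) nbR.
have := @KU_le R _ _ _ hn => g1 g2; rewrite eK.
have : (c + 2 + 18 * e1) * P%:R <= (c + 2 + eta) * P%:R by rewrite ler_wpM2r // lerD2l.
lra.
Qed.

(** * Classes of blocks for the image, the fibres and the exceptional sets *)

Definition raw_bits : seq (seq bool) := [:: [:: true]; [:: false]].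

Definition im_len (st : nat -> stage) (c : nat) := if c is k.+1 then sm (st k) else 1%N.
Definition im_beta (st : nat -> stage) (c : nat) := if c is k.+1 then sb1 (st k) else 1%N.
Definition im_list (st : nat -> stage) (c : nat) (x : seq bool) :=
  if c is k.+1 then sL1 (st k) else raw_bits.
Definition fib_beta (st : nat -> stage) (c : nat) := if c is k.+1 then sb2 (st k) else 1%N.
Definition fib_list (st : nat -> stage) (c : nat) (x : seq bool) :=
  if c is k.+1 then sL2 (st k) x else raw_bits.

(* Class [2k + 1]: exceptional blocks of stage [k]; class [2k + 2]: all blocks of stage [k]. *)
Definition exc_len (st : nat -> stage) (c : nat) := if c is c'.+1 then sm (st c'./2) else 1%N.
Definition exc_beta (st : nat -> stage) (e c : nat) :=
  if c is c'.+1 then if odd c' then sm (st c'./2) else sb3 (st c'./2) e else 1%N.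
Definition exc_list (st : nat -> stage) (e c : nat) (x : seq bool) :=
  if c is c'.+1 then
    if odd c' then low (sm (st c'./2)) (sm (st c'./2)) else sS (st c'./2) e
  else raw_bits.

(** The decoder for tolerance [e] is covered by the common constant from stage [e] on, and the
    stages tend to infinity. *)
Lemma slow_change st kappa kappa' kk e : slow st kappa kk ->
  (forall k, (sm (st k) <= kappa' k)%N) ->
  (forall k, (e <= k)%N -> (kappa' k <= kappa k)%N) -> slow st kappa' kk.
Proof.
move=> [h1 h2 h3 [j0 hj0]] hs hk; split=> //.
  by move=> k; have /andP[-> _] := h1 k; rewrite hs.
have [j1 hj1] := h3 e; exists (maxn j0 j1) => j; rewrite geq_max => /andP[g0 g1].
apply: leq_trans (hj0 j g0); rewrite leq_mul2l hk ?orbT //; exact: hj1.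
Qed.

Lemma KU_lower (R : realType) U (Z : nat -> bool) (a eta : R) : 0 < eta ->
  cdim U Z = a%:E -> exists n0, forall n, (n0 <= n)%N -> (a - eta) * n%:R <= KU U (restr Z n).
Proof.
move=> eta0 hZ; have [|n0 hn0] := limn_einf_gt hZ (b := a - eta); first by lra.
exists n0.+1 => n hn; have n1 : 0 < n%:R :> R by rewrite ltr0n; lia.
by have := hn0 n (ltnW hn); rewrite ltr_pdivlMr // => /ltW.
Qed.

Definition bad_block st kk e (Z : nat -> bool) j : bool :=
  (e <= kk j)%N && (blk st kk Z j \in sS (st (kk j)) e).

Lemma hamming_tail (Z W : nat -> bool) a t :
  (hamming (restr Z a) (restr W a) <= hamming (restr Z (a + t)) (restr W (a + t))
    <= hamming (restr Z a) (restr W a) + t)%N.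
Proof.
rewrite !restrD hamming_cat ?size_mkseq // leq_addr leq_add2l.
by apply: leq_trans (hamming_le _ _) _; rewrite size_mkseq.
Qed.

(** An index in the exceptional set saves a fraction [delta e] of a bad block; as K(Z|n) >= (1 -
    o(1)) n, the total saving is o(n). *)
Lemma bad_blocks_rare (R : realType) U s r delta st kappa kk :
  (forall e, 0 < delta e :> R) -> (forall k, stage_ok s r delta k (st k)) ->
  forall e, slow st kappa kk ->
  (forall k bs, all (vblock (exc_len st) (exc_beta st e) (exc_list st e) (2 * k + 3)) bs ->
     (forall b, b \in bs -> bx b = nseq (exc_len st b.1) false) ->
     exists n, kol_le U (flatten (map by_ bs)) n /\
       (k.+1 * n <= (k.+1 + 3) * (\sum_(b <- bs) bcost (exc_beta st e) b) + kappa k)%N) ->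
  forall Z, cdim U Z = (1 : R)%:E -> forall eta, 0 < eta ->
  exists n0, forall J, (n0 <= pos st kk J)%N ->
    \sum_(j < J) (bad_block st kk e Z j)%:R * (blen st kk j)%:R <= eta * (pos st kk J)%:R :> R.
Proof.
move=> d0 hst e hs hk Z hZ eta eta0.
pose cls j := if bad_block st kk e Z j then (2 * kk j).+1 else (2 * kk j).+2.
pose w j : R := delta e * ((bad_block st kk e Z j)%:R * (blen st kk j)%:R).
have h2 : 0 < eta * delta e / 2 by rewrite divr_gt0 // mulr_gt0.
have odd2 k : odd (2 * k) = false by rewrite mul2n odd_double.
have half2 k : (2 * k)./2 = k by rewrite mul2n doubleK.
have half21 k : uphalf (2 * k) = k by rewrite mul2n uphalf_double.
have hcls j : [/\ (cls j < 2 * kk j + 3)%N, exc_len st (cls j) = blen st kk j,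
     blk st kk Z j \in exc_list st e (cls j) (blk st kk (fun=> false) j) &
     (size (exc_list st e (cls j) (blk st kk (fun=> false) j)) <= 2 ^ exc_beta st e (cls j))%N].
  rewrite /cls; case: ifP => [/andP[ek hb]|_];
    rewrite /exc_len /exc_list /exc_beta /= odd2 /= ?half2 ?half21.
    have [_ _ _ _ hh] := hst (kk j); have [sz _ _ _] := hh e ek.
    by split=> //; lia.
  split=> //; first lia; first by apply: mem_all_strings; exact: size_blk.
  by rewrite size_low ball_size_le.
have hcost : exists j0, forall j, (j0 <= j)%N -> (cls j + 1 + exc_beta st e (cls j))%N%:R + w j <=
     (1 + 2 * eps (kk j)) * (blen st kk j)%:R.
  exists 0%N => j _; have [[m0 me] _ _ _ hh] := hst (kk j); rewrite /w /cls.
  have e0 : 0 <= eps (kk j) * (blen st kk j)%:R :> R by rewrite mulr_ge0 // ltW // eps_gt0.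
  case: (boolP (bad_block st kk e Z j)) => hb; rewrite /exc_beta /= odd2 /= ?half2 ?half21.
    move/andP: (hb) => [ek _]; have [_ sz _ _] := hh e ek.
    by move: me sz e0; rewrite /blen !natrD; lra.
  by move: me e0; rewrite /blen !natrD; lra.
have raw : raw_class (exc_len st) (exc_beta st e) (exc_list st e) by split.
have c14 : 0 <= (1 : R) <= 4 by lra.
have w0 j : 0 <= w j by rewrite mulr_ge0 ?mulr_ge0 // ltW.
have [n1 hn1] := KU_rate hs raw hk hcls c14 w0 hcost h2.
have [n2 hn2] := KU_lower h2 hZ.
exists (maxn n1 n2) => J; rewrite geq_max => /andP[g1 g2].
have bJ : (0 < blen st kk J)%N by have [h1 _ _ _] := hs; have /andP[] := h1 (kk J).
have := hn1 J 0%N bJ; rewrite addn0 => /(_ g1).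
have := hn2 _ g2; rewrite /w -mulr_sumr.
set T := \sum_(j < J) _; set P := (pos _ _ _)%:R => k1 k2.
rewrite -(ler_pM2l (d0 e)); lra.
Qed.

(** * The encoded sequence *)

Lemma KU_enc_upper (R : realType) U s r delta st kappa kk (Y : nat -> bool) : 0 <= s <= 1 ->
  (forall k, @stage_ok R s r delta k (st k)) -> slow st kappa kk ->
  (forall k bs, all (vblock (im_len st) (im_beta st) (im_list st) (2 * k + 3)) bs ->
     (forall b, b \in bs -> bx b = nseq (im_len st b.1) false) ->
     exists n, kol_le U (flatten (map by_ bs)) n /\
       (k.+1 * n <= (k.+1 + 3) * (\sum_(b <- bs) bcost (im_beta st) b) + kappa k)%N) ->
  forall eta : R, 0 < eta -> exists n0, forall n, (n0 <= n)%N ->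
    KU U (restr (enc_seq st kk Y) n) <= (s + eta) * n%:R.
Proof.
move=> /andP[s0 s1] hst hs hk eta eta0.
have sm0 k : (0 < sm (st k))%N by have [[]] := hst k.
have sF k y : size y = sm (st k) -> size (sF (st k) y) = sm (st k).
  by move=> sy; have [_ h _ _ _] := hst k; have [] := h y sy.
have hcls j : [/\ ((kk j).+1 < 2 * kk j + 3)%N, im_len st (kk j).+1 = blen st kk j,
    blk st kk (enc_seq st kk Y) j \in im_list st (kk j).+1 (blk st kk (fun=> false) j) &
    (size (im_list st (kk j).+1 (blk st kk (fun=> false) j)) <= 2 ^ im_beta st (kk j).+1)%N].
  have [_ h [h1 _] _ _] := hst (kk j).
  split=> //; first lia.
  by rewrite blk_enc_seq //; have [] := h _ (size_blk st kk Y j).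
have hcost : exists j0, forall j, (j0 <= j)%N ->
    ((kk j).+1 + 1 + im_beta st (kk j).+1)%N%:R + 0 <= (s + 2 * eps (kk j)) * (blen st kk j)%:R :> R.
  exists 0%N => j _; have [[_ me] _ [_ h1] _ _] := hst (kk j).
  rewrite addr0; apply: (@le_trans _ _ ((2 * kk j + 3)%N%:R + (sb1 (st (kk j)))%:R)).
    by rewrite -natrD ler_nat /=; lia.
  by rewrite /blen; lra.
have raw : raw_class (im_len st) (im_beta st) (im_list st) by split.
have c14 : 0 <= s <= 4 by lra.
have [n1 hn1] := KU_rate (w := fun=> 0) hs raw hk hcls c14 (fun=> lexx 0) hcost eta0.
exists n1 => n hn; have [J [t [en lt]]] := pos_locate kk n sm0.
have := hn1 J t lt; rewrite -en => /(_ hn).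
by rewrite big1 ?addr0.
Qed.

(** Each block of [Y] lies in the fibre list of the corresponding block of [X]. With dim(Y) = 1 this
    bounds K(X|n) from below. *)
Lemma KU_enc_lower (R : realType) U (hU : optimal_pf_machine U) s r delta st kappa kk
    (Y : nat -> bool) : 0 <= s <= 1 ->
  (forall k, @stage_ok R s r delta k (st k)) -> slow st kappa kk ->
  (forall k bs, all (vblock (im_len st) (fib_beta st) (fib_list st) (2 * k + 3)) bs ->
     forall K, kol_le U (flatten (map bx bs)) K ->
     exists n, kol_le U (flatten (map by_ bs)) n /\
       (k.+1 * n <= (k.+1 + 3) * (K + \sum_(b <- bs) bcost (fib_beta st) b) + kappa k)%N) ->
  (exists n0, forall n, (n0 <= n)%N -> KU U (restr (enc_seq st kk Y) n) <= 2 * n%:R :> R) ->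
  forall eta : R, 0 < eta -> exists n0, forall n, (n0 <= n)%N ->
    KU U (restr Y n) <= KU U (restr (enc_seq st kk Y) n) + (1 - s + eta) * n%:R.
Proof.
move=> /andP[s0 s1] hst hs hk hX eta eta0.
have sm0 k : (0 < sm (st k))%N by have [[]] := hst k.
have sF k y : size y = sm (st k) -> size (sF (st k) y) = sm (st k).
  by move=> sy; have [_ h _ _ _] := hst k; have [] := h y sy.
have hcls j : [/\ ((kk j).+1 < 2 * kk j + 3)%N, im_len st (kk j).+1 = blen st kk j,
    blk st kk Y j \in fib_list st (kk j).+1 (blk st kk (enc_seq st kk Y) j) &
    (size (fib_list st (kk j).+1 (blk st kk (enc_seq st kk Y) j)) <= 2 ^ fib_beta st (kk j).+1)%N].
  have [_ h _ [h1 _] _] := hst (kk j).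
  split=> //; [lia| |exact: h1].
  by rewrite blk_enc_seq //; have [] := h _ (size_blk st kk Y j).
have hcost : exists j0, forall j, (j0 <= j)%N ->
    ((kk j).+1 + 1 + fib_beta st (kk j).+1)%N%:R <= (1 - s + 2 * eps (kk j)) * (blen st kk j)%:R :> R.
  exists 0%N => j _; have [[_ me] _ _ [_ h1] _] := hst (kk j).
  apply: (@le_trans _ _ ((2 * kk j + 3)%N%:R + (sb2 (st (kk j)))%:R)).
    by rewrite -natrD ler_nat /=; lia.
  by rewrite /blen; lra.
have raw : raw_class (im_len st) (fib_beta st) (fib_list st) by split.
have c14 : 0 <= 1 - s <= 1 by lra.
have [n1 hn1] := KU_rate_cond hU hs raw hk hcls c14 hcost hX eta0.
exists n1 => n hn; have [J [t [en lt]]] := pos_locate kk n sm0.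
by have := hn1 J t lt; rewrite -en => /(_ hn).
Qed.

(** A bad block is charged its full length; the finitely many blocks of stages before [e] go into
    the constant [C]. *)
Lemma hamming_enc_upper (R : realType) s r delta st kappa kk (Y : nat -> bool) : 0 <= r <= 1 ->
  (forall k, @stage_ok R s r delta k (st k)) -> slow st kappa kk ->
  (forall e (eta : R), 0 < eta -> exists n0, forall J, (n0 <= pos st kk J)%N ->
    \sum_(j < J) (bad_block st kk e Y j)%:R * (blen st kk j)%:R <= eta * (pos st kk J)%:R :> R) ->
  forall eta : R, 0 < eta -> exists n0, forall n, (n0 <= n)%N ->
    (hamming (restr (enc_seq st kk Y) n) (restr Y n))%:R <= (r + eta) * n%:R.
Proof.
move=> /andP[r0 r1] hst hs hbad eta eta0.
have sm0 k : (0 < sm (st k))%N by have [[]] := hst k.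
have sF k y : size y = sm (st k) -> size (sF (st k) y) = sm (st k).
  by move=> sy; have [_ h _ _ _] := hst k; have [] := h y sy.
have e40 : 0 < eta / 4 by rewrite divr_gt0.
have [e he] := eps_small e40; have {}he := he e (leqnn e).
have [n1 hn1] := hbad e _ e40.
have [_ _ unb _] := hs; have [j1 hj1] := unb e.
have [|C C0 hC] := @sum_eventually R
  (fun j => (hamming (blk st kk (enc_seq st kk Y) j) (blk st kk Y j))%:R)
  (fun j => (r + eps e) * (blen st kk j)%:R +
     (bad_block st kk e Y j)%:R * (blen st kk j)%:R) j1.
  move=> j /hj1 ej; have [_ _ _ _ h] := hst (kk j); have [_ _ near _] := h e ej.
  rewrite blk_enc_seq // /bad_block ej /=; case: (boolP (_ \in _)) => hS.
    rewrite mul1r ler_wpDl // ?mulr_ge0 // ?addr_ge0 // ?(ltW (eps_gt0 _ _)) //.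
    by rewrite ler_nat (leq_trans (hamming_le _ _)) // sF ?size_blk.
  by rewrite mul0r addr0; apply: near => //; exact: size_blk.
have [n2 hn2] := slow_eventually hs e40.
have [n3 hn3] := natr_large C e40.
have [n4 hn4] : exists n4, forall J t, (t < blen st kk J)%N -> (n4 <= pos st kk J + t)%N ->
    (n1 <= pos st kk J)%N.
  exists (pos st kk n1.+1) => J t lt h; apply: leq_trans (pos_ge kk J sm0).
  rewrite leqNgt; apply/negP => lJ.
  have : (pos st kk J.+1 <= pos st kk n1.+1)%N by apply: pos_mono; apply: leqW.
  by rewrite posS; lia.
exists (maxn n2 (maxn n3 n4)) => n; rewrite !geq_max => /and3P[g2 g3 g4].
have [J [t [en lt]]] := pos_locate kk n sm0; subst n.
have [_ _ ht] := hn2 J t lt g2; have hc := hn3 _ g3; have hb := hn1 J (hn4 J t lt g4).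
have := hC J; rewrite big_split /= -mulr_sumr -pos_natr -natr_sum -hamming_restr_pos => hp.
have /andP[_] := hamming_tail (enc_seq st kk Y) Y (pos st kk J) t.
rewrite -(ler_nat R) natrD => htl.
rewrite natrD in ht hc *.
move: hp hb htl ht hc; set p := (pos _ _ _)%:R; set u := t%:R => hp hb htl ht hc.
have u0 : 0 <= u by []. have p0 : 0 <= p by [].
have h5 : eps e * p <= eta / 4 * p by rewrite ler_wpM2r.
have h6 : 0 <= r * u by rewrite mulr_ge0.
have h7 : 0 <= eta * u by rewrite mulr_ge0 // ltW.
lra.
Qed.

(** Block boundaries are enough here, because the distance is a limsup. *)
Lemma hamming_enc_lower (R : realType) s r delta st kappa kk (Y Z : nat -> bool) : r <= 1 ->
  (forall k, @stage_ok R s r delta k (st k)) -> slow st kappa kk ->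
  (forall e (eta : R), 0 < eta -> exists n0, forall J, (n0 <= pos st kk J)%N ->
    \sum_(j < J) (bad_block st kk e Z j)%:R * (blen st kk j)%:R <= eta * (pos st kk J)%:R :> R) ->
  forall eta : R, 0 < eta -> exists n0, forall J, (n0 <= pos st kk J)%N ->
    (r - eta) * (pos st kk J)%:R <=
      (hamming (restr (enc_seq st kk Y) (pos st kk J)) (restr Z (pos st kk J)))%:R.
Proof.
move=> r1 hst hs hbad eta eta0.
have sm0 k : (0 < sm (st k))%N by have [[]] := hst k.
have sF k y : size y = sm (st k) -> size (sF (st k) y) = sm (st k).
  by move=> sy; have [_ h _ _ _] := hst k; have [] := h y sy.
have e40 : 0 < eta / 4 by rewrite divr_gt0.
have [e he] := eps_small e40; have {}he := he e (leqnn e).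
have [n1 hn1] := hbad e _ e40.
have [_ _ unb _] := hs; have [j1 hj1] := unb e.
have [|C C0 hC] := @sum_eventually R
  (fun j => (r - eps e) * (blen st kk j)%:R)
  (fun j => (hamming (blk st kk (enc_seq st kk Y) j) (blk st kk Z j))%:R +
     (bad_block st kk e Z j)%:R * (blen st kk j)%:R) j1.
  move=> j /hj1 ej; have [_ _ _ _ h] := hst (kk j); have [_ _ _ far] := h e ej.
  rewrite blk_enc_seq // /bad_block ej /=; case: (boolP (_ \in _)) => hS.
    rewrite mul1r ler_wpDl // ler_piMl //.
    have := eps_gt0 R e; lra.
  by rewrite mul0r addr0; apply: far => //; exact: size_blk.
have [n3 hn3] := natr_large C e40.
exists (maxn n1 n3) => J; rewrite geq_max => /andP[g1 g3].
have hc := hn3 _ g3; have hb := hn1 J g1.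
have := hC J; rewrite big_split /= -mulr_sumr -pos_natr -natr_sum -hamming_restr_pos.
move: hb hc; set p := (pos _ _ _)%:R => hb hc hp.
have p0 : 0 <= p by [].
have h5 : eps e * p <= eta / 4 * p by rewrite ler_wpM2r.
have h7 : 0 <= eta * p by rewrite mulr_ge0 // ltW.
lra.
Qed.

Theorem theorem1p5 (R : realType) (U : prcode) (hU : optimal_pf_machine U)
  (s r : R) (hs : 0 <= s <= 1)
  (hr : Hinv (1 - s) <= r <= 2^-1 - Hinv s)
  (Y : nat -> bool) (hY : cdim U Y = (1 : R)%:E) :
  exists X : nat -> bool,
    [/\ cdim U X = s%:E, pdim U X = s%:E, dist1 U X = r%:E & hdist X Y = r%:E].
Proof.
have [delta [st [d0 hst]]] := stages_exist hs (code_part_exists hs hr).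
have sm0 k : (0 < sm (st k))%N by have [[]] := hst k.
have /choice[k1 hk1] k := kol_le_blocks hU (im_len st) (im_beta st) (im_list st) (2 * k + 3)
  (ltn0Sn k).
have /choice[k2 hk2] k := kol_le_blocks_cond hU (im_len st) (fib_beta st) (fib_list st)
  (2 * k + 3) (ltn0Sn k).
have /choice[k3 hk3] (e : nat) : exists f : nat -> nat, forall k bs,
    all (vblock (exc_len st) (exc_beta st e) (exc_list st e) (2 * k + 3)) bs ->
    (forall b, b \in bs -> bx b = nseq (exc_len st b.1) false) ->
    exists n, kol_le U (flatten (map by_ bs)) n /\
    (k.+1 * n <= (k.+1 + 3) * (\sum_(b <- bs) bcost (exc_beta st e) b) + f k)%N.
  have /choice[f hf] k := kol_le_blocks hU (exc_len st) (exc_beta st e) (exc_list st e)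
    (2 * k + 3) (ltn0Sn k).
  by exists f.
(* Each tolerance has its own decoder; charging stage [k] with those for e <= k makes a single [kk]
   slow enough for all of them. *)
pose kappa k := (k1 k + k2 k + \sum_(e < k.+1) k3 e k + sm (st k))%N.
have [kk [mono unb bnd]] := slow_stage kappa.
have hslow : slow st kappa kk by split=> // k; rewrite sm0 leq_addl.
have add_kappa (f : nat -> nat) k N M : (k.+1 * N <= M + f k)%N ->
    (k.+1 * N <= M + (f k + sm (st k)))%N by move=> h; rewrite addnA (leq_trans h) // leq_addr.
pose X := enc_seq st kk Y; exists X.
have r01 : 0 <= r <= 1.
  have [h1 _] := @HinvP R (1 - s) ltac:(lra).
  have [h2 _] := HinvP hs.
  lra.
have bad Z : cdim U Z = (1 : R)%:E -> forall e (eta : R), 0 < eta ->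
    exists n0, forall J, (n0 <= pos st kk J)%N ->
    \sum_(j < J) (bad_block st kk e Z j)%:R * (blen st kk j)%:R <= eta * (pos st kk J)%:R :> R.
  move=> hZ e eta eta0.
  have sl : slow st (fun k => k3 e k + sm (st k))%N kk.
    apply: (slow_change (e := e) hslow) => k; first exact: leq_addl.
    move=> ek; rewrite leq_add2r.
    have : (k3 (Ordinal (ek : e < k.+1)%N) k <= \sum_(i < k.+1) k3 i k)%N.
      by rewrite (bigD1 (Ordinal (ek : e < k.+1)%N)) //= leq_addr.
    by move=> /= h; apply: leq_trans h _; rewrite leq_addl.
  apply: (bad_blocks_rare d0 hst sl _ hZ eta0) => k bs h1 h2.
  by have [n [hn1 hn2]] := hk3 e k bs h1 h2; exists n; split=> //; exact: add_kappa.
have sl1 : slow st (fun k => k1 k + sm (st k))%N kk.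
  apply: (slow_change (e := 0) hslow) => k; first exact: leq_addl.
  by move=> _; rewrite leq_add2r /kappa -addnA leq_addr.
have sl2 : slow st (fun k => k2 k + sm (st k))%N kk.
  apply: (slow_change (e := 0) hslow) => k; first exact: leq_addl.
  by move=> _; rewrite leq_add2r addnAC leq_addl.
have KXu : forall eta : R, 0 < eta -> exists n0, forall n, (n0 <= n)%N ->
    KU U (restr X n) <= (s + eta) * n%:R.
  apply: (KU_enc_upper Y hs hst sl1) => k bs h1 h2.
  by have [n [hn1 hn2]] := hk1 k bs h1 h2; exists n; split=> //; exact: add_kappa.
have KX2 : exists n0, forall n, (n0 <= n)%N -> KU U (restr X n) <= 2 * n%:R :> R.
  have [n0 hn0] := KXu 1 ltr01; exists n0 => n /hn0 h; apply: le_trans h _.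
  by rewrite ler_wpM2r //; lra.
have KXl : forall eta : R, 0 < eta -> exists n0, forall n, (n0 <= n)%N ->
    KU U (restr Y n) <= KU U (restr X n) + (1 - s + eta) * n%:R.
  apply: (KU_enc_lower hU hs hst sl2 _ KX2) => k bs h1 K h2.
  by have [n [hn1 hn2]] := hk2 k bs h1 K h2; exists n; split=> //; exact: add_kappa.
(* The lower half is (1 - o(1)) n <= K(Y|n) <= K(X|n) + (1 - s + o(1)) n. *)
have [dX pX] : cdim U X = s%:E /\ pdim U X = s%:E.
  apply: limn_einf_esup_eq => eta eta0; have h2 : 0 < eta / 2 by rewrite divr_gt0.
  have [n1 hn1] := KXu _ eta0; have [n2 hn2] := KXl _ h2.
  have [n3 hn3] := KU_lower h2 hY.
  exists (maxn n1 (maxn n2 n3)).+1 => n hn.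
  have n0 : 0 < n%:R :> R by rewrite ltr0n; lia.
  have := hn1 n ltac:(lia); have := hn2 n ltac:(lia); have := hn3 n ltac:(lia) => g1 g2 g3.
  by rewrite ler_pdivlMr // ler_pdivrMr // g3 andbT; lra.
have far Z : cdim U Z = (1 : R)%:E -> (r%:E <= hdist X Z)%E.
  move=> hZ; apply: limn_esup_ge => eta eta0 n0.
  have r1 : r <= 1 by have /andP[] := r01.
  have [n1 hn1] := hamming_enc_lower Y r1 hst hslow (bad Z hZ) eta0.
  pose J := (maxn n0 n1).+1.
  have Jp : (J <= pos st kk J)%N by exact: pos_ge.
  exists (pos st kk J); first by rewrite /J in Jp *; lia.
  rewrite hdist_hamming ler_pdivlMr; last by rewrite ltr0n; rewrite /J in Jp *; lia.
  by apply: hn1; rewrite /J in Jp *; lia.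
have hXY : hdist X Y = r%:E.
  apply/eqP; rewrite eq_le far // andbT.
  apply: limn_esup_le => eta eta0.
  have [n1 hn1] := hamming_enc_upper r01 hst hslow (bad Y hY) eta0.
  exists n1.+1 => n hn; have n0 : 0 < n%:R :> R by rewrite ltr0n; lia.
  by rewrite hdist_hamming ler_pdivrMr //; apply: hn1; lia.
split=> //; apply/eqP; rewrite eq_le; apply/andP; split.
  (* The infimum is attained at [Y] itself. *)
  by rewrite -hXY; apply: ereal_inf_lbound; exists Y.
by apply: le_ereal_inf_tmp => _ [Z hZ <-]; exact: far.
Qed.
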